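(* Let $\mathbf{X}=\{X(t)\}_{t\ge0}$ be a full operator stable Lévy process on $\mathbb{R}^2$ with an exponent $B$ in one of the Jordan forms $B_0,B_1,B_2,B_3$ listed in the context, and let $\mu=\mathcal{L}(X(1))$ be the law of $X(1)$, with symmetry group $\mathcal{S}(\mu)$. Then the following hold. (i) If $B=B_1$, then $\mathcal{S}(\mu)$ is either $\mathcal{C}_1$, $\mathcal{C}_2$, $\mathcal{D}_1$, $\mathcal{D}_1^*$, or $\mathcal{D}_2$. (ii) If $B=B_2$, then $\mathcal{S}(\mu)$ is either $\mathcal{C}_n$ for some $n\ge1$, or $\mathcal{O}_2$. (iii) If $B=B_3$, then $\mathcal{S}(\mu)$ is either $\mathcal{C}_1$ or $\mathcal{C}_2$.
   Context: For $t>0$ and a real matrix $B$, $t^B:=\exp(B\log t)$. A Lévy process $\mathbf{X}$ in $\mathbb{R}^d$ is operator stable with exponent $B\in\mathrm{GL}(\mathbb{R}^d)$ if for every $t>0$ there is $b(t)\in\mathbb{R}^d$ with $X(t)\stackrel{d}{=}t^BX(1)+b(t)$. It is full if $\mu=\mathcal{L}(X(1))$ is not supported on a lower dimensional hyperplane. The symmetry group is $$\mathcal{S}(\mu)=\{A\in\mathrm{GL}(\mathbb{R}^d): A\mu=\mu*\delta_x\text{ for some }x\in\mathbb{R}^d\},$$ where $A\mu$ is the image of $\mu$ under $A$. Jordan forms: $$B_0=bI,\quad B_1=\begin{bmatrix}b_1&0\\0&b_2\end{bmatrix},\quad B_2=\begin{bmatrix}b&-c\\c&b\end{bmatrix},\quad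 B_3=\begin{bmatrix}b&0\\1&b\end{bmatrix},$$ where $b,b_1,b_2>1/2$, $b_1\neq b_2$, and $c\neq0$. $\mathcal{O}_2=\{R_\theta,F_\theta:\theta\in[0,2\pi)\}$ is the orthogonal group of $\mathbb{R}^2$, where $$R_\theta=\begin{bmatrix}\cos\theta&-\sin\theta\\ \sin\theta&\cos\theta\end{bmatrix},\qquad F_\theta=\begin{bmatrix}\cos\theta&\sin\theta\\ \sin\theta&-\cos\theta\end{bmatrix}.$$ For $n\ge1$, $\mathcal{C}_n=\{R_{2\pi k/n}:k=0,\dots,n-1\}$ and $\mathcal{D}_n=\{R_{2\pi k/n},F_{2\pi k/n}:k=0,\dots,n-1\}$. In particular $\mathcal{C}_1=\{I\}$, $\mathcal{C}_2=\{I,-I\}$, $\mathcal{D}_1=\{I,F_0\}$, $\mathcal{D}_2=\{I,F_0,-I,-F_0\}$ with $F_0=\mathrm{diag}(1,-1)$. Also $\mathcal{D}_1^*=\{I,-F_0\}$. *)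

(* Defs.v *)
From HB Require Import structures.
From mathcomp Require Import all_boot all_order all_algebra.
From mathcomp Require Import all_classical all_reals all_analysis.

Set Implicit Arguments.
Unset Strict Implicit.
Unset Printing Implicit Defensive.
Import Order.TTheory GRing.Theory Num.Theory.
Import numFieldNormedType.Exports.

Local Open Scope classical_set_scope.
Local Open Scope ring_scope.

HB.instance Definition _ (R : realType) (m n : nat) :=
  Measurable.copy 'M[R]_(m, n) (g_sigma_algebraType (@open 'M[R]_(m, n))).

Section matrix_power.
Context {R : realType} {d : nat}.

Definition mexp (A : 'M[R]_d) : 'M[R]_d :=
  limn (fun n => \sum_(0 <= k < n) (k`!%:R)^-1 *: A ^+ k).

Definition mpow (t : R) (B : 'M[R]_d) : 'M[R]_d := mexp (ln t *: B).

End matrix_power.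

Section processes.
Context {R : realType} {dO : measure_display} {Omega : measurableType dO}.
Context {P : probability Omega R} {d : nat}.

(* The factors A i may be the whole space, so this is the product rule for
   every subfamily. *)
Definition mutually_independent (n : nat) (Y : 'I_n -> Omega -> 'cV[R]_d) :=
  forall A : 'I_n -> set 'cV[R]_d, (forall i, measurable (A i)) ->
    P (\bigcap_i (Y i @^-1` A i)) = (\prod_(i < n) P (Y i @^-1` A i))%E.

Definition eq_in_law (Y Z : Omega -> 'cV[R]_d) :=
  forall E : set 'cV[R]_d, measurable E -> pushforward P Y E = pushforward P Z E.

Definition cadlag (f : R -> 'cV[R]_d) :=
  (forall t, 0 <= t -> f s @[s --> t^'+] --> f t) /\
  (forall t, 0 < t -> exists l : 'cV[R]_d, f s @[s --> t^'-] --> l).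

(* Processes are indexed by all of R, but only the times t >= 0 matter. *)
Implicit Type X : R -> {RV P >-> 'cV[R]_d}.

Definition increment X (t : nat -> R) (i : nat) : Omega -> 'cV[R]_d :=
  if i is j.+1 then fun w => X (t j.+1) w - X (t j) w else X (t 0%N).

Definition independent_increments X :=
  forall (n : nat) (t : nat -> R), 0 <= t 0%N ->
    (forall i, (i < n)%N -> t i < t i.+1) ->
    mutually_independent (fun i : 'I_n.+1 => increment X t i).

Definition stationary_increments X :=
  forall s t, 0 <= s -> 0 <= t -> eq_in_law (fun w => X (s + t) w - X s w) (X t).

Definition stochastically_continuous X :=
  forall t eps, 0 <= t -> 0 < eps ->
    P [set w | eps < `|X s w - X t w|]
      @[s --> within [set s | 0 <= s] (nbhs t)] --> 0%E.

Definition levy_process X :=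
  [/\ {ae P, forall w, X 0 w = 0},
      independent_increments X,
      stationary_increments X,
      stochastically_continuous X &
      {ae P, forall w, cadlag (fun t => X t w)}].

Definition operator_stable X (B : 'M[R]_d) :=
  B \in unitmx /\
  forall t, 0 < t -> exists b : 'cV[R]_d,
    eq_in_law (X t) (fun w => mpow t B *m X 1 w + b).

End processes.

Section symmetries.
Context {R : realType} {d : nat}.

(* Hyperplanes are affine: they need not contain the origin. *)
Definition full (mu : probability 'cV[R]_d R) :=
  forall (u : 'rV[R]_d) (c : R), u != 0 ->
    mu [set x : 'cV[R]_d | (u *m x) 0 0 = c] != 1%E.

Definition convolution (mu nu : {measure set 'cV[R]_d -> \bar R}) :
    set 'cV[R]_d -> \bar R :=
  pushforward (mu \x nu)%E (fun p : 'cV[R]_d * 'cV[R]_d => p.1 + p.2).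

Definition symmetry_group (mu : probability 'cV[R]_d R) : set 'M[R]_d :=
  [set A | A \in unitmx /\ exists x : 'cV[R]_d, forall E, measurable E ->
     pushforward mu (mulmx A : 'cV[R]_d -> 'cV[R]_d) E = convolution mu \d_x E].

End symmetries.

Section plane.
Context {R : realType}.

Definition mx2 (a11 a12 a21 a22 : R) : 'M[R]_2 :=
  \matrix_(i, j) nth 0 (nth [::] [:: [:: a11; a12]; [:: a21; a22]] i) j.

Definition jordan0 : set 'M[R]_2 := [set B | exists b, 1 / 2 < b /\ B = b%:M].

Definition jordan1 : set 'M[R]_2 :=
  [set B | exists b1 b2, [/\ 1 / 2 < b1, 1 / 2 < b2, b1 != b2 &
    B = mx2 b1 0
            0  b2]].

Definition jordan2 : set 'M[R]_2 :=
  [set B | exists b c, [/\ 1 / 2 < b, c != 0 &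
    B = mx2 b (- c)
            c b]].

Definition jordan3 : set 'M[R]_2 :=
  [set B | exists b, 1 / 2 < b /\
    B = mx2 b 0
            1 b].

Definition rot (theta : R) : 'M[R]_2 :=
  mx2 (cos theta) (- sin theta)
      (sin theta) (cos theta).

Definition refl (theta : R) : 'M[R]_2 :=
  mx2 (cos theta) (sin theta)
      (sin theta) (- cos theta).

Definition O2 : set 'M[R]_2 :=
  [set A | exists theta,
    0 <= theta < 2 * pi /\ (A = rot theta \/ A = refl theta)].

Definition Cgrp (n : nat) : set 'M[R]_2 :=
  [set rot (2 * pi * k%:R / n%:R) | k in [set k | (k < n)%N]].

Definition Dgrp (n : nat) : set 'M[R]_2 :=
  Cgrp n `|` [set refl (2 * pi * k%:R / n%:R) | k in [set k | (k < n)%N]].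

Definition D1star : set 'M[R]_2 := [set 1%:M; - refl 0].

End plane.

(* Main.v *)
(* Let S be the symmetry group of mu.  Fullness makes S a bounded group, so its
   elements have determinant 1 or -1, those of determinant 1 have trace in
   [-2, 2], and no unipotent matrix other than 1 belongs to S.  By independence
   of the increments, a symmetry of X(1) is one of X(n), and X(n) is n^B X(1) up
   to a shift; hence S is stable under conjugation by n^B for every n >= 1.

   For B1 and B3 boundedness of n^-B A n^B forces A to be triangular, for B3
   with a double eigenvalue; the unipotent matrices (n^-B A n^B) A^-1, respectively
   A^2, are then trivial, which leaves only signs on the diagonal.  For
   B2 the conjugations are rotations by c log n.  For A in S, the product of A^-1
   with its conjugate has determinant 1 and its trace is at most 2 in absolute
   value only if A is orthogonal.  If S contains a reflection, conjugating it
   yields the rotations by 2 c (log (n+2) - log (n+1)), which tend to 0.  So S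
   either contains no reflection and has discrete rotation angles, hence is
   cyclic, or it contains arbitrarily small rotations.  In the latter case these
   rotations have a common centre m, mu is invariant under all rotations about m,
   and Fubini's theorem for the law of conj (x * conj y) / |y|, with x and y
   independent copies centred at m, gives the invariance under a reflection. *)
From HB Require Import structures.
Require Import Defs.
From mathcomp Require Import all_boot all_order all_algebra.
From mathcomp Require Import all_classical all_reals all_analysis.
From mathcomp Require Import measurable_realfun ring lra.
Import Defs.
Import Order.TTheory GRing.Theory Num.Theory.
Import numFieldNormedType.Exports.
Local Open Scope classical_set_scope.
Local Open Scope ring_scope.

Set Implicit Arguments.
Unset Strict Implicit.
Unset Printing Implicit Defensive.

(** * Borel sets of matrices *)

Section matrix_measurability.
Context {R : realType} {m n : nat}.

Lemma open_measurable_mx (U : set 'M[R]_(m, n)) : open U -> measurable U.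
Proof. by move=> oU; exact: sub_sigma_algebra. Qed.

Lemma closed_measurable_mx (U : set 'M[R]_(m, n)) : closed U -> measurable U.
Proof.
by move=> /closed_openC/open_measurable_mx/measurableC; rewrite setCK.
Qed.

Lemma measurable_coord (i : 'I_m) (j : 'I_n) :
  measurable_fun setT (fun M : 'M[R]_(m, n) => M i j).
Proof.
apply: (measurability _ (RGenOpens.measurableE R)).
move=> _ [_ [a [b ->] <-]]; rewrite setTI; apply: open_measurable_mx.
have /continuousP : continuous (fun M : 'M[R]_(m, n) => M i j).
  exact: coord_continuous.
by apply; exact: interval_open.
Qed.

(** Second countability in explicit form: boxes with rational centre and radius [k.+1%:R^-1] form a
    countable base. Taking the radius below [e / 2] keeps the whole box inside the [e]-ball about
    [M]. *)
Lemma open_subset_rational_box (U : set 'M[R]_(m, n)) (M : 'M[R]_(m, n)) :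
  open U -> U M -> exists (C : 'M[rat]_(m, n)) (k : nat),
    (forall i j, `|ratr (C i j) - M i j| < k.+1%:R^-1) /\
    (forall N : 'M[R]_(m, n),
      (forall i j, `|ratr (C i j) - N i j| < k.+1%:R^-1) -> U N).
Proof.
move=> oU UM; have /nbhs_ballP[e /= e0 eU] : nbhs M U by exact: open_nbhs_nbhs.
have [k ke] : exists k, k.+1%:R^-1 < e / 2.
  have [k _ /(_ k (leqnn k))] := near_infty_natSinv_lt (PosNum (divr_gt0 e0 (ltr0Sn R 1))).
  by exists k.
have k0 : 0 < k.+1%:R^-1 :> R by rewrite invr_gt0 ltr0n.
have /(_ _ _)/cid C i j : exists q : rat, `|ratr q - M i j| < k.+1%:R^-1.
  have /rat_in_itvoo[q] : M i j < M i j + k.+1%:R^-1 by rewrite ltrDl.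
  rewrite in_itv/= => /andP[Mq qM]; exists q.
  by rewrite gtr0_norm ?subr_gt0// ltrBlDl.
exists (\matrix_(i, j) sval (C i j)), k; split=> [i j|N CN].
  by rewrite mxE; exact: (svalP (C i j)).
apply: eU; split=> // i j; rewrite /ball/=.
have := CN i j; rewrite mxE; have := svalP (C i j).
move: (sval _) => q Mq Nq; have : `|M i j - N i j| <= `|ratr q - M i j| + `|ratr q - N i j|.
  by rewrite -[`|ratr q - M i j|]distrC; apply: le_trans (ler_normD _ _); rewrite addrA subrK.
move=> /le_lt_trans; apply; rewrite (splitr e) ltrD//; exact: lt_trans ke.
Qed.

(** The sigma-algebra on matrices is generated by the open sets, not by the coordinates. The two
    agree because an open set is a countable union of rational boxes, and each box is a finite
    intersection of coordinate conditions. *)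
Lemma measurable_fun_mx d (T : measurableType d) (f : T -> 'M[R]_(m, n)) :
  (forall i j, measurable_fun setT (fun t => f t i j)) -> measurable_fun setT f.
Proof.
move=> mf; apply: (@measurability _ _ _ _ _ _ (@open 'M[R]_(m, n))) => // _ [U oU <-].
rewrite setTI.
pose D := [set p : 'M[rat]_(m, n) * nat | forall N : 'M[R]_(m, n),
      (forall i j, `|ratr (p.1 i j) - N i j| < p.2.+1%:R^-1) -> U N].
pose F (p : 'M[rat]_(m, n) * nat) := \bigcap_(i in [set: 'I_m]) \bigcap_(j in [set: 'I_n])
   [set t | `|ratr (p.1 i j) - f t i j| < p.2.+1%:R^-1].
have -> : f @^-1` U = \bigcup_(p in D) F p.
  apply/seteqP; split=> [t /= Uft|t [p Dp Fp]].
    have [C [k [Ck CU]]] := open_subset_rational_box oU Uft.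
    by exists (C, k) => // i _ j _ /=.
  by apply: Dp => i j; exact: (Fp i I j I).
rewrite bigcup_mkcond; apply: countable_bigcupT_measurable; first exact: countableP.
move=> p.
case: ifPn => // _; apply: fin_bigcap_measurable => // i _.
apply: fin_bigcap_measurable => // j _.
have mh : measurable_fun setT (fun t => `|ratr (p.1 i j) - f t i j|).
  apply: measurableT_comp => //; apply: measurable_funB => //.
have := mh measurableT [set x | x < p.2.+1%:R^-1]; rewrite setTI; apply.
have -> : [set x : R | x < p.2.+1%:R^-1] = `]-oo, p.2.+1%:R^-1[%classic.
  by apply/seteqP; split=> x /=; rewrite in_itv.
exact: measurable_itv.
Qed.

End matrix_measurability.

Section matrix_operations.
Context {R : realType}.

Lemma measurable_mulmx m n p (A : 'M[R]_(m, n)) :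
  measurable_fun setT (mulmx A : 'M[R]_(n, p) -> _).
Proof.
apply: measurable_fun_mx => i j; under eq_fun do rewrite mxE.
apply: measurable_sum => k; apply: measurable_funM => //.
exact: measurable_coord.
Qed.

Lemma measurable_addmx m n d (T : measurableType d) (f g : T -> 'M[R]_(m, n)) :
  measurable_fun setT f -> measurable_fun setT g ->
  measurable_fun setT (fun t => f t + g t).
Proof.
move=> mf mg; apply: measurable_fun_mx => i j; under eq_fun do rewrite mxE.
apply: measurable_funD.
- by apply: (measurableT_comp (measurable_coord i j) mf).
- by apply: (measurableT_comp (measurable_coord i j) mg).
Qed.

End matrix_operations.

Definition mfun_of d d' (T : measurableType d) (T' : measurableType d')
    (f : T -> T') (mf : measurable_fun setT f) : {mfun T >-> T'} :=
  HB.pack f (isMeasurableFun.Build _ _ _ _ f mf).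

(** The tail unions decrease to the lim sup and each has mass at least [p], so continuity from above
    applies. This carries lower bounds on probabilities to a limit without any convergence of the
    sets themselves. *)
Lemma limsup_prob_ge d (T : measurableType d) (R : realType)
    (mu : probability T R) (F : (set T)^nat) (E : set T) (p : \bar R) :
  (forall n, measurable (F n)) -> measurable E ->
  (forall n, p <= mu (F n))%E -> lim_sup_set F `<=` E -> (p <= mu E)%E.
Proof.
move=> mF mE pF FE.
have mU n : measurable (\bigcup_(k >= n) F k) by exact: bigcup_measurable.
have mL : measurable (lim_sup_set F) by exact: bigcapT_measurable.
apply: (@le_trans _ _ (mu (lim_sup_set F))); last first.
  by apply: le_measure => //; rewrite inE.
have cF : (mu (\bigcup_(k >= n) F k) @[n --> \oo] --> mu (lim_sup_set F)).
  apply: lim_sup_set_cvg => //.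
  by rewrite (le_lt_trans (probability_le1 _ _)) ?ltry.
rewrite -(cvg_lim _ cF)//; apply: lime_ge; first exact: (cvgP _ cF).
apply: nearW => n; apply: le_trans (pF n) _.
by apply: le_measure; rewrite ?inE// => t Ft; exists n => /=.
Qed.

(** * Equality in law and sums of independent vectors *)

Section equality_in_law.
Context {R : realType} {d : nat} {dO : measure_display}
  {Omega : measurableType dO} (P : probability Omega R).
Implicit Types Y Z : Omega -> 'cV[R]_d.

Lemma eq_in_law_sym Y Z : eq_in_law (P := P) Y Z -> eq_in_law (P := P) Z Y.
Proof. by move=> YZ E mE; rewrite YZ. Qed.

Lemma eq_in_law_trans Y Z W :
  eq_in_law (P := P) Y Z -> eq_in_law (P := P) Z W -> eq_in_law (P := P) Y W.
Proof. by move=> YZ ZW E mE; rewrite YZ// ZW. Qed.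

Lemma eq_in_law_comp (h : 'cV[R]_d -> 'cV[R]_d) Y Z : measurable_fun setT h ->
  eq_in_law (P := P) Y Z ->
  eq_in_law (P := P) (fun w => h (Y w)) (fun w => h (Z w)).
Proof.
move=> mh YZ E mE; rewrite /pushforward.
by have := YZ (h @^-1` E); apply; rewrite -[X in measurable X]setTI; exact: mh.
Qed.

Definition independent2 Y Z := forall A B, measurable A -> measurable B ->
  P (Y @^-1` A `&` Z @^-1` B) = (P (Y @^-1` A) * P (Z @^-1` B))%E.

(** By independence both joint laws agree with the product of the marginals of [Y] and [Z] on
    rectangles, hence everywhere; the sum is a measurable function of the pair. *)
Lemma eq_in_law_add Y Z Y' Z' :
  measurable_fun setT Y -> measurable_fun setT Z ->
  measurable_fun setT Y' -> measurable_fun setT Z' ->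
  independent2 Y Z -> independent2 Y' Z' ->
  eq_in_law (P := P) Y Y' -> eq_in_law (P := P) Z Z' ->
  eq_in_law (P := P) (fun w => Y w + Z w) (fun w => Y' w + Z' w).
Proof.
move=> mY mZ mY' mZ' iYZ iYZ' eY eZ E mE.
pose m1 : probability _ R := distribution P (mfun_of mY).
pose m2 : probability _ R := distribution P (mfun_of mZ).
have mS : measurable ((fun p : 'cV[R]_d * 'cV[R]_d => p.1 + p.2) @^-1` E).
  rewrite -[X in measurable X]setTI; apply: measurable_addmx => //.
have YZ : measurable_fun setT (fun w => (Y w, Z w)).
  exact: measurable_fun_pair.
have YZ' : measurable_fun setT (fun w => (Y' w, Z' w)).
  exact: measurable_fun_pair.
pose S := (fun p : 'cV[R]_d * 'cV[R]_d => p.1 + p.2) @^-1` E.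
have law1 : (m1 \x m2)%E S = distribution P (mfun_of YZ) S.
  by apply: product_measure_unique => // A B mA mB; exact: iYZ.
have law2 : (m1 \x m2)%E S = distribution P (mfun_of YZ') S.
  apply: product_measure_unique => // A B mA mB.
  apply: (etrans (iYZ' _ _ mA mB)); congr (_ * _)%E; apply: esym.
  - exact: eY.
  - exact: eZ.
exact: etrans (esym law1) law2.
Qed.

End equality_in_law.

Section translates.
Context {R : realType} {d : nat}.
Implicit Types mu : probability 'cV[R]_d R.

Lemma measurable_addr (x : 'cV[R]_d) :
  measurable_fun setT (fun z : 'cV[R]_d => z + x).
Proof. exact: measurable_addmx. Qed.

(** Convolution with a Dirac mass is translation, since [mu \x \d_x] is the law of [(z, x)].
    Membership becomes an equality in law of two maps on the probability space carrying [mu]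
    itself. *)
Lemma symmetry_groupP mu (A : 'M[R]_d) : symmetry_group mu A <->
  A \in unitmx /\ exists x, eq_in_law (P := mu) (mulmx A) (fun z => z + x).
Proof.
have conv x E : measurable E ->
    convolution mu \d_x E = pushforward mu (fun z => z + x) E.
  move=> mE; rewrite /convolution /pushforward.
  have mx : measurable_fun setT (fun z : 'cV[R]_d => (z, x)).
    exact: measurable_fun_pair.
  apply: (etrans (y := distribution mu (mfun_of mx)
      ((fun p : 'cV[R]_d * 'cV[R]_d => p.1 + p.2) @^-1` E))) => //.
  apply: product_measure_unique.
    move=> B C mB mC; rewrite /distribution /pushforward/= diracE.
    case: (boolP (x \in C)) => xC.
    - rewrite mule1; congr (mu _); apply/seteqP; split=> z //=; first by case.
      by split=> //; exact: set_mem.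
    - rewrite mule0 -(measure0 mu); congr (mu _); apply/seteqP; split=> z //= [_].
      by move=> /mem_set; exact/negP.
  rewrite -[X in measurable X]setTI; exact: measurable_addmx.
by split=> -[uA [x Ax]]; split=> //; exists x => E mE; rewrite Ax// conv.
Qed.

End translates.

(** * The symmetry group *)

Section symmetry_group_is_group.
Context {R : realType} {d : nat} (mu : probability 'cV[R]_d R).
Implicit Types A B : 'M[R]_d.

Lemma symmetry_group1 : symmetry_group mu 1%:M.
Proof.
apply/symmetry_groupP; split; first exact: unitmx1.
by exists 0 => E mE; congr (mu _); apply/seteqP; split=> z /=;
  rewrite mul1mx addr0.
Qed.

Lemma symmetry_groupM A B :
  symmetry_group mu A -> symmetry_group mu B -> symmetry_group mu (A *m B).
Proof.
move=> /symmetry_groupP[uA [x Ax]] /symmetry_groupP[uB [y By]].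
apply/symmetry_groupP; split; first by rewrite unitmx_mul uA.
exists (x + A *m y).
have := eq_in_law_comp (measurable_mulmx A) By.
have := eq_in_law_comp (measurable_addr (A *m y)) Ax.
move=> h1 h2 E mE.
have := h1 E mE; have := h2 E mE; rewrite /pushforward => e2 e1.
transitivity (mu ((fun z => A *m (B *m z)) @^-1` E)).
  by congr (mu _); apply/seteqP; split=> z /=; rewrite mulmxA.
rewrite e2; transitivity (mu ((fun z => A *m z + A *m y) @^-1` E)).
  by congr (mu _); apply/seteqP; split=> z /=; rewrite mulmxDr.
by rewrite e1; congr (mu _); apply/seteqP; split=> z /=; rewrite addrA.
Qed.

Lemma symmetry_groupV A : symmetry_group mu A -> symmetry_group mu (invmx A).
Proof.
move=> /symmetry_groupP[uA [x Ax]].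
apply/symmetry_groupP; split; first by rewrite unitmx_inv.
exists (- (invmx A *m x)) => E mE.
have mh : measurable_fun setT (fun z : 'cV[R]_d => invmx A *m z - invmx A *m x).
  by apply: measurable_addmx => //; exact: measurable_mulmx.
have := eq_in_law_comp mh Ax mE; rewrite /pushforward => e.
transitivity (mu ((fun z => invmx A *m (z + x) - invmx A *m x) @^-1` E)).
  by congr (mu _); apply/seteqP; split=> z /=; rewrite mulmxDr addrK.
by rewrite -e; congr (mu _); apply/seteqP; split=> z /=; rewrite mulKmx.
Qed.

End symmetry_group_is_group.

(** * Symmetries along the process and their conjugates *)

Section levy_conjugation.
Context {R : realType} {dO : measure_display} {Omega : measurableType dO}.
Context {P : probability Omega R} {d : nat}.
Variable X : R -> {RV P >-> 'cV[R]_d}.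
Hypothesis LX : levy_process X.
Let mu : probability 'cV[R]_d R := distribution P (X 1).

Lemma measurable_process t : measurable_fun setT (X t).
Proof. exact: measurable_funPT. Qed.

Lemma measurable_increment s t :
  measurable_fun setT (fun w => X t w - X s w).
Proof.
apply: measurable_addmx; first exact: measurable_process.
have -> : (fun w => - X s w) = (fun w => (- 1%:M) *m X s w).
  by apply/funext => w; rewrite mulNmx mul1mx.
exact: (measurableT_comp (measurable_mulmx _) (measurable_process s)).
Qed.

Lemma increment_independent s t : 0 <= s -> s < t ->
  independent2 P (X s) (fun w => X t w - X s w).
Proof.
move=> s0 st A B mA mB; have [_ iX _ _ _] := LX.
have /= := iX 1 (fun i => if i is 0 then s else t) s0.
have h i : (i < 1)%N -> (if i is 0 then s else t) < t by case: i.
move=> /(_ h) /(_ (fun i => if i == ord0 then A else B)).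
have mAB (i : 'I_2) : measurable (if i == ord0 then A else B) by case: ifPn.
move=> /(_ mAB); rewrite !big_ord_recl big_ord0 mule1/= => <-.
congr (P _); apply/seteqP; split=> w /=.
  move=> [Aw Bw] i _; case: (unliftP ord0 i) => [j|] ->/=; last by [].
  by rewrite (ord1 j).
by move=> h'; split; [exact: (h' ord0 I)|exact: (h' (lift ord0 ord0) I)].
Qed.

(** Induction on [n]: the increment over the next unit of time is independent of the past and
    distributed as [X 1], so it has the symmetry [A] with the same shift [x], and the shifts add
    up. *)
Lemma levy_symmetry A n : symmetry_group mu A -> exists y,
  eq_in_law (P := P) (fun w => A *m X n.+1%:R w) (fun w => X n.+1%:R w + y).
Proof.
move=> /symmetry_groupP[_ [x Ax]].
have {}Ax : eq_in_law (P := P) (fun w => A *m X 1 w) (fun w => X 1 w + x).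
  exact: Ax.
elim: n => [|n [y IH]]; first by exists x.
have n0 : 0 <= n.+1%:R :> R by rewrite ler0n.
have n1 : n.+1%:R < n.+2%:R :> R by rewrite ltr_nat.
have iX := increment_independent n0 n1.
pose Z w := X n.+2%:R w - X n.+1%:R w.
have mZ : measurable_fun setT Z by exact: measurable_increment.
have ZX : eq_in_law (P := P) Z (X 1).
  have [_ _ sX _ _] := LX; have := sX n.+1%:R 1 n0 ler01.
  by rewrite natr1.
have mA : measurable_fun setT (mulmx A : 'cV[R]_d -> 'cV[R]_d).
  exact: measurable_mulmx.
have AZ : eq_in_law (P := P) (fun w => A *m Z w) (fun w => Z w + x).
  apply: eq_in_law_trans (eq_in_law_comp mA ZX) _.
  apply: eq_in_law_trans Ax _; apply: eq_in_law_sym.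
  by apply: (eq_in_law_comp (measurable_addr x)).
exists (y + x) => E mE.
have := @eq_in_law_add _ _ _ _ P (fun w => A *m X n.+1%:R w) (fun w => A *m Z w)
  (fun w => X n.+1%:R w + y) (fun w => Z w + x).
have mX := measurable_process n.+1%:R.
have pre (h : 'cV[R]_d -> 'cV[R]_d) B : measurable_fun setT h ->
    measurable B -> measurable (h @^-1` B).
  by move=> mh mB; rewrite -[X in measurable X]setTI; exact: mh.
have H : forall f g : 'cV[R]_d -> 'cV[R]_d, measurable_fun setT f ->
    measurable_fun setT g ->
    independent2 P (fun w => f (X n.+1%:R w)) (fun w => g (Z w)).
  by move=> f g mf mg B C mB mC; exact: (iX _ _ (pre f B mf mB) (pre g C mg mC)).
move=> /(_ (measurableT_comp mA mX) (measurableT_comp mA mZ)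
  (measurableT_comp (measurable_addr y) mX)
  (measurableT_comp (measurable_addr x) mZ) (H _ _ mA mA)
  (H _ _ (measurable_addr y) (measurable_addr x)) IH AZ E mE).
rewrite /pushforward => e.
transitivity (P ((fun w => A *m X n.+1%:R w + A *m Z w) @^-1` E)).
  by congr (P _); apply/seteqP; split=> w /=; rewrite -mulmxDr /Z addrC subrK.
rewrite e; congr (P _); apply/seteqP; split=> w /=;
  by rewrite addrACA /Z [X n.+1%:R w + _]addrC subrK.
Qed.

(** The symmetry [A] of [X n.+1%:R] is pulled back to [X 1] along the affine map [z |-> M z + b];
    the translation parts only alter the shift. *)
Lemma symmetry_group_conj (M : 'M[R]_d) A b n : M \in unitmx ->
  eq_in_law (P := P) (X n.+1%:R) (fun w => M *m X 1 w + b) ->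
  symmetry_group mu A -> symmetry_group mu (invmx M *m A *m M).
Proof.
move=> uM XM SA; have [y Ay] := levy_symmetry n SA.
have uA : A \in unitmx by case: SA.
apply/symmetry_groupP; split; first by rewrite !unitmx_mul unitmx_inv uM uA.
exists (invmx M *m (b + y - A *m b)).
(* Chosen so that [h (A (M z + b)) = M^-1 A M z], while [h (M z + b + y)] is a translate of [z]. *)
pose h (z : 'cV[R]_d) := invmx M *m (z - A *m b).
have mh : measurable_fun setT h.
  apply: (measurableT_comp (measurable_mulmx _)); exact: measurable_addr.
have mA : measurable_fun setT (mulmx A : 'cV[R]_d -> 'cV[R]_d).
  exact: measurable_mulmx.
have e : eq_in_law (P := P) (fun w => h (A *m (M *m X 1 w + b)))
    (fun w => h (M *m X 1 w + b + y)).
  apply: (eq_in_law_comp mh).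
  apply: (eq_in_law_trans (eq_in_law_sym (eq_in_law_comp mA XM))).
  apply: eq_in_law_trans Ay _.
  exact: (eq_in_law_comp (measurable_addr y) XM).
move=> E mE; have := e E mE; rewrite /pushforward/= => {}e.
transitivity (P ((fun w => h (A *m (M *m X 1 w + b))) @^-1` E)).
  rewrite /mu /= /distribution /pushforward; congr (P _); apply/seteqP.
  by split=> w /=; rewrite /h mulmxDr addrK !mulmxA.
have hE z : h (M *m z + b + y) = z + invmx M *m (b + y - A *m b).
  by rewrite /h -!addrA mulmxDr mulKmx.
rewrite e /mu /= /distribution /pushforward; congr (P _); apply/seteqP.
by split=> w /=; rewrite hE.
Qed.

End levy_conjugation.

(** The indices come from a cluster point and need not increase; [m <= k m] is enough to send them
    to infinity, and the rate of approximation is explicit. *)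
Lemma compact_subsequence (R : realType) (V : normedModType R) (K : set V)
    (u : nat -> V) : compact K -> (forall n, K (u n)) ->
  exists2 l, K l & exists k : nat -> nat,
    forall m, (m <= k m)%N /\ `|l - u (k m)| < m.+1%:R^-1.
Proof.
move=> cK Ku.
have [|l [Kl cl]] := cK (u @ \oo) _; first by exists 0%N => // n _; exact: Ku.
exists l => //.
suff h m : exists n, (m <= n)%N /\ `|l - u n| < m.+1%:R^-1.
  by have [k hk] := choice h; exists k.
have [] := cl [set u n | n in [set n | (m <= n)%N]] (ball l m.+1%:R^-1).
- by exists m => // n /= mn; exists n.
- by apply: nbhsx_ballx; rewrite invr_gt0 ltr0n.
- by move=> _ [[n mn <-]]; rewrite -ball_normE /= => ?; exists n.
Qed.

(** The bound is asked only along infinitely many [n], which is what membership in a lim sup of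
    events supplies. *)
Lemma le_inv_nat_eq0 (R : realType) (c x : R) :
  (forall N : nat, exists2 n, (N <= n)%N & `|x| <= c / n.+1%:R) -> x = 0.
Proof.
move=> h; apply/normr0_eq0/eqP; rewrite eq_le normr_ge0 andbT leNgt.
apply/negP => x0.
have c0 : 0 <= c.
  have [n _ /(le_trans (normr_ge0 x))] := h 0%N.
  by rewrite pmulr_lge0// invr_gt0 ltr0n.
have [n /ltW cn] : exists n : nat, c / `|x| < n%:R.
  by exists (Num.bound (c / `|x|)); apply: archi_boundP; rewrite divr_ge0.
have [m nm] := h n; rewrite ler_pdivlMr ?ltr0n//.
apply/negP; rewrite -ltNge; rewrite ler_pdivrMr// in cn.
by apply: (le_lt_trans cn); rewrite mulrC ltr_pM2l// ltr_nat.
Qed.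

Lemma ler_norm_mulmx (R : realType) n (v : 'rV[R]_n) (z : 'cV[R]_n) :
  `|(v *m z) 0 0| <= `|v| * \sum_j `|z j 0|.
Proof.
rewrite mxE mulr_sumr; apply: le_trans (ler_norm_sum _ _ _) _.
apply: ler_sum => j _; rewrite normrM; apply: ler_wpM2r => //.
rewrite [leRHS]/Num.norm/= mx_normrE.
exact: (le_bigmax _ (fun i : 'I_1 * 'I_n => `|v i.1 i.2|) (0, j)).
Qed.

(** * Fullness and boundedness of the symmetry group *)

Section symmetry_group_bounded.
Context {R : realType} {d : nat} (mu : probability 'cV[R]_d R).

Lemma slab_measurable (v : 'rV[R]_d) (c K : R) :
  measurable [set z : 'cV[R]_d | `|(v *m z) 0 0 - c| <= K].
Proof.
have mf : measurable_fun setT (fun z : 'cV[R]_d => `|(v *m z) 0 0 - c|).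
  apply: measurableT_comp => //; apply: measurable_funB => //.
  exact: (measurableT_comp (measurable_coord 0 0) (measurable_mulmx v)).
have := mf measurableT [set x | x <= K]; rewrite setTI; apply.
have -> : [set x : R | x <= K] = `]-oo, K]%classic.
  by apply/seteqP; split=> x /=; rewrite in_itv.
exact: measurable_itv.
Qed.

Lemma hyperplane_measurable (v : 'rV[R]_d) (c : R) :
  measurable [set z : 'cV[R]_d | (v *m z) 0 0 = c].
Proof.
suff -> : [set z : 'cV[R]_d | (v *m z) 0 0 = c] =
          [set z | `|(v *m z) 0 0 - c| <= 0] by exact: slab_measurable.
apply/seteqP; split=> z /=; first by move=> ->; rewrite subrr normr0.
by rewrite normr_le0 subr_eq0 => /eqP.
Qed.

Lemma slab_cvg1 (v : 'rV[R]_d) (c : R) :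
  mu [set z | `|(v *m z) 0 0 - c| <= K%:R] @[K --> \oo] --> 1%E.
Proof.
pose G (K : nat) := [set z : 'cV[R]_d | `|(v *m z) 0 0 - c| <= K%:R].
have GT : \bigcup_K G K = setT.
  apply/seteqP; split=> // z _.
  exists (Num.bound `|(v *m z) 0 0 - c|) => //; rewrite /G /=.
  by apply/ltW/archi_boundP.
rewrite -(@probability_setT _ _ _ mu) -GT.
apply: nondecreasing_cvg_mu.
- by move=> K; exact: slab_measurable.
- by rewrite GT.
- move=> K1 K2 K12; apply/subsetPset => z; rewrite /G /= => /le_trans; apply.
  by rewrite ler_nat.
Qed.

(* If rows of [A n] in the symmetry group were unbounded, then, after
   normalising the affine forms [z |-> (A n z - x n) i], which all have the law
   of [z |-> z i], a limit point would vanish almost surely. *)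
Lemma symmetry_group_row_bounded i : full mu -> exists C, forall A,
  symmetry_group mu A -> forall j, `|A i j| <= C.
Proof.
move=> fmu; apply: contrapT => /forallNP nb.
have /choice[Ax hAx] (n : nat) : exists Ax : 'M[R]_d * 'cV[R]_d,
    eq_in_law (P := mu) (mulmx Ax.1) (fun z => z + Ax.2) /\
    exists j, n.+1%:R < `|Ax.1 i j|.
  have /existsNP[A /not_implyP[SA /existsNP[j /negP]]] := nb n.+1%:R.
  rewrite -ltNge => nA.
  by have /symmetry_groupP[_ [x eA]] := SA; exists (A, x); split=> //; exists j.
(* The affine form [z |-> (A z - x) i] is encoded as one row vector, to be paired with the column
   [(z, -1)]; normalising it then controls the linear part and the constant together. *)
pose w n : 'rV[R]_(d + 1) := row_mx (row i (Ax n).1) (((Ax n).2 i 0)%:M).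
have entry_le (v : 'rV[R]_(d + 1)) j : `|v 0 j| <= `|v|.
  rewrite [leRHS]/Num.norm/= mx_normrE.
  exact: (le_bigmax _ (fun i : 'I_1 * 'I_(d + 1) => `|v i.1 i.2|) (0, j)).
have w_gt n : n.+1%:R < `|w n|.
  have [_ [j /lt_le_trans]] := hAx n; apply.
  have := entry_le (w n) (lshift 1 j).
  by rewrite /w row_mxEl mxE.
have w_gt0 n : 0 < `|w n| by apply: lt_trans (w_gt n); rewrite ltr0n.
pose u n := `|w n|^-1 *: w n.
have Ku n : [set v : 'rV[R]_(d + 1) | `|v| = 1] (u n).
  by rewrite /= /u normrZ gtr0_norm ?invr_gt0// mulVf// gt_eqF.
have cK : compact [set v : 'rV[R]_(d + 1) | `|v| = 1].
  apply: bounded_closed_compact.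
    by exists 1; split; [exact: num_real|move=> M M1 v /= ->; exact: ltW].
  have -> : [set v : 'rV[R]_(d + 1) | `|v| = 1] = Num.norm @^-1` [set 1].
    by [].
  apply: preimage_closed; last exact: closed_eq.
  by move=> v _; exact: norm_continuous.
have [l l1 [k hk]] := compact_subsequence cK Ku.
pose H := [set z : 'cV[R]_d | (lsubmx l *m z) 0 0 = (rsubmx l) 0 0].
have mH : measurable H by exact: hyperplane_measurable.
pose e_ : 'rV[R]_d := delta_mx 0 i.
have ez (z : 'cV[R]_d) : (e_ *m z) 0 0 = z i 0.
  by rewrite /e_ -rowE mxE.
have rowz (A : 'M[R]_d) (z : 'cV[R]_d) : (row i A *m z) 0 0 = (A *m z) i 0.
  by rewrite -row_mul mxE.
pose p (K : nat) := mu [set z : 'cV[R]_d | `|(e_ *m z) 0 0 - 0| <= K%:R].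
have pH K : (p K <= mu H)%E.
  (* The form [(A z - x) i] has the law of [z i], so each [F m] has mass [p K], independently of
     [m]. *)
  pose F m := [set z : 'cV[R]_d |
    `|(row i (Ax (k m)).1 *m z) 0 0 - (Ax (k m)).2 i 0| <= K%:R].
  apply: (@limsup_prob_ge _ _ _ mu F) => //.
  - by move=> m; exact: slab_measurable.
  - move=> m; rewrite /p.
    have [/(_ [set z : 'cV[R]_d | `|(e_ *m z) 0 0 - (Ax (k m)).2 i 0| <= K%:R])] := hAx (k m).
    rewrite /pushforward => /(_ (slab_measurable _ _ _)) e _.
    rewrite le_eqVlt; apply/orP; left; apply/eqP.
    transitivity (mu ((fun z => z + (Ax (k m)).2) @^-1`
      [set z : 'cV[R]_d | `|(e_ *m z) 0 0 - (Ax (k m)).2 i 0| <= K%:R])).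
      by congr (mu _); apply/seteqP; split=> z /=; rewrite !ez mxE addrK subr0.
    rewrite -e /F; congr (mu _); apply/seteqP; split=> z /=;
      by rewrite ez rowz.
  - move=> z Fz; rewrite /H /=; apply/eqP; rewrite -subr_eq0; apply/eqP.
    pose zz : 'cV[R]_(d + 1) := col_mx z (- 1)%:M.
    have lz (v : 'rV[R]_(d + 1)) :
        (v *m zz) 0 0 = (lsubmx v *m z) 0 0 - (rsubmx v) 0 0.
      rewrite -[v in LHS]hsubmxK /zz mul_row_col mxE; congr (_ + _).
      by rewrite mul_mx_scalar mxE mulN1r.
    apply: (@le_inv_nat_eq0 _ (K%:R + \sum_j `|zz j 0|)) => N.
    have [m /= Nm Fm] := Fz N I; exists m => //.
    (* Split the limit form as [u (k m)] plus a remainder. On [F m] the first part is at most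
       [K / |w (k m)|], hence at most [K / m.+1]; the remainder has norm below [1 / m.+1]. *)
    have [mk lk] := hk m.
    rewrite -lz -[l](subrK (u (k m))) mulmxDl mxE.
    apply: (le_trans (ler_normD _ _)); rewrite mulrDl addrC lerD//.
      rewrite /u -scalemxAl mxE normrM gtr0_norm ?invr_gt0// mulrC.
      apply: ler_pM => //.
        by rewrite lz /w row_mxKl row_mxKr [(_%:M) 0 0]mxE eqxx mulr1n.
      rewrite lef_pV2 ?posrE ?ltr0n//; apply/ltW.
      by apply: le_lt_trans (w_gt _); rewrite ler_nat ltnS.
    apply: le_trans (ler_norm_mulmx _ _) _; rewrite mulrC.
    by apply: ler_wpM2l; [exact: sumr_ge0|exact: ltW].
have p1 : p K @[K --> \oo] --> 1%E by exact: slab_cvg1.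
have H1 : mu H = 1%E.
  apply/eqP; rewrite eq_le probability_le1//=.
  rewrite -(cvg_lim _ p1)//; apply: lime_le; first exact: (cvgP _ p1).
  exact: nearW.
(* A nonzero linear part would make [H] a hyperplane of full mass. Otherwise [l] is a nonzero
   constant form, and [H] is empty although it has mass 1. *)
have [l0|l0] := eqVneq (lsubmx l) 0; last by have := fmu _ ((rsubmx l) 0 0) l0; rewrite H1 eqxx.
have lr : (rsubmx l) 0 0 != 0.
  apply/eqP => r0; have : l = 0.
    rewrite -[l]hsubmxK l0; have -> : rsubmx l = 0.
      by apply/rowP => j; rewrite (ord1 j) r0 mxE.
    by rewrite row_mx0.
  by move=> E; move: l1; rewrite /= E normr0 => /eqP; rewrite eq_sym oner_eq0.
have H0 : H = set0.
  apply/seteqP; split=> z //; rewrite /H /= l0 mul0mx mxE => E.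
  by move: lr; rewrite -E eqxx.
by move: H1; rewrite H0 measure0 => /eqP; rewrite eq_sym onee_eq0.
Qed.

Lemma symmetry_group_bounded : full mu -> exists C, forall A,
  symmetry_group mu A -> forall i j, `|A i j| <= C.
Proof.
move=> fmu; have /choice[C hC] i := symmetry_group_row_bounded i fmu.
exists (\big[Num.max/0]_i C i) => A SA i j.
by apply: le_trans (hC i A SA j) _; exact: le_bigmax.
Qed.

End symmetry_group_bounded.

(** * Bounded groups of plane matrices *)

Section plane_matrices.
Context {R : realType}.
Implicit Types (A : 'M[R]_2) (a b c d p q r s x y u v : R).

Lemma ord2P (i : 'I_2) : i = 0 \/ i = 1.
Proof. by case: i => -[|[|//]] h; [left|right]; apply: val_inj. Qed.

Lemma mx2E A : A = mx2 (A 0 0) (A 0 1) (A 1 0) (A 1 1).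
Proof.
by apply/matrixP => i j; rewrite mxE; have [->|->] := ord2P i;
  have [->|->] := ord2P j.
Qed.

Lemma mx2_inj a b c d p q r s : mx2 a b c d = mx2 p q r s ->
  [/\ a = p, b = q, c = r & d = s].
Proof.
move=> /matrixP h; split.
- by have := h 0 0; rewrite !mxE.
- by have := h 0 1; rewrite !mxE.
- by have := h 1 0; rewrite !mxE.
- by have := h 1 1; rewrite !mxE.
Qed.

Lemma mul_mx2 a b c d p q r s : mx2 a b c d *m mx2 p q r s =
  mx2 (a * p + b * r) (a * q + b * s) (c * p + d * r) (c * q + d * s).
Proof.
by apply/matrixP => i j; rewrite !mxE !big_ord_recl big_ord0 !mxE addr0;
  have [->|->] := ord2P i; have [->|->] := ord2P j.
Qed.

Lemma scale_mx2 x a b c d :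
  x *: mx2 a b c d = mx2 (x * a) (x * b) (x * c) (x * d).
Proof.
by apply/matrixP => i j; rewrite !mxE; have [->|->] := ord2P i;
  have [->|->] := ord2P j.
Qed.

Lemma opp_mx2 a b c d : - mx2 a b c d = mx2 (- a) (- b) (- c) (- d).
Proof.
by apply/matrixP => i j; rewrite !mxE; have [->|->] := ord2P i;
  have [->|->] := ord2P j.
Qed.

Lemma scalar_mx2 x : x%:M = mx2 x 0 0 x.
Proof.
by apply/matrixP => i j; rewrite !mxE; have [->|->] := ord2P i;
  have [->|->] := ord2P j.
Qed.

Lemma tr_mx2 a b c d : (mx2 a b c d)^T = mx2 a c b d.
Proof.
by apply/matrixP => i j; rewrite !mxE; have [->|->] := ord2P i;
  have [->|->] := ord2P j.
Qed.

Lemma det_mx2 a b c d : \det (mx2 a b c d) = a * d - b * c.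
Proof.
rewrite (expand_det_row _ 0) !big_ord_recl big_ord0 /cofactor !det_mx11 !mxE /=.
by rewrite expr0 expr1 mul1r mulN1r mulrN addr0.
Qed.

Lemma trace_mx2 a b c d : \tr (mx2 a b c d) = a + d.
Proof. by rewrite /mxtrace !big_ord_recl big_ord0 !mxE addr0. Qed.

Lemma invmx_mx2 a b c d : a * d - b * c != 0 -> invmx (mx2 a b c d) =
  (a * d - b * c)^-1 *: mx2 d (- b) (- c) a.
Proof.
move=> D0; have uA : mx2 a b c d \in unitmx by rewrite unitmxE det_mx2 unitfE.
apply: (can_inj (mulKmx uA)); rewrite mulmxV// -scalemxAr mul_mx2 scale_mx2.
by rewrite scalar_mx2; congr mx2; field.
Qed.

End plane_matrices.

Section bounded_groups.
Context {R : realType}.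
Implicit Types (G : set 'M[R]_2) (A : 'M[R]_2) (p q r s x u v a b : R).

Definition bounded_group G := [/\ forall A, G A -> A \in unitmx, G 1%:M,
  forall A B, G A -> G B -> G (A *m B), forall A, G A -> G (invmx A) &
  exists C, forall A, G A -> forall i j, `|A i j| <= C].

(** Transposition exchanges upper and lower triangular matrices, so arguments about one corner entry
    carry over to the other. *)
Lemma bounded_group_tr G : bounded_group G -> bounded_group [set A | G A^T].
Proof.
move=> [uG G1 GM GV [C GC]]; split=> /=.
- by move=> A /uG; rewrite unitmx_tr.
- by rewrite trmx1.
- by move=> A B GA GB; rewrite trmx_mul; exact: GM.
- by move=> A /GV; rewrite trmx_inv.
- by exists C => A GA i j; have := GC _ GA j i; rewrite mxE.
Qed.

Lemma bounded_multiples_le0 (x K : R) :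
  (forall k : nat, k%:R * x <= K) -> x <= 0.
Proof.
move=> h; rewrite leNgt; apply/negP => x0.
have := h (Num.bound `|K / x|); apply/negP; rewrite -ltNge -ltr_pdivrMr//.
by apply: le_lt_trans (ler_norm _) _; apply: archi_boundP.
Qed.

Section in_bounded_group.
Variable G : set 'M[R]_2.
Hypothesis bG : bounded_group G.

Lemma bounded_group_power A k : G A -> G (A ^+ k).
Proof.
have [_ G1 GM _ _] := bG => GA; elim: k => [|k IH]; first by rewrite expr0.
by rewrite exprS; exact: GM.
Qed.

Lemma bernoulli_ge x k : 0 <= x -> 1 + k%:R * (x - 1) <= x ^+ k.
Proof.
move=> x0; elim: k => [|k IH]; first by rewrite mul0r addr0.
rewrite exprS; apply: le_trans (ler_wpM2l x0 IH).
have : 0 <= k%:R * (x - 1) ^+ 2 by rewrite mulr_ge0 ?sqr_ge0.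
rewrite -natr1; set y := k%:R; nra.
Qed.

(** Determinants of powers of [A] stay bounded, while by Bernoulli a square above 1 would have
    powers growing at least linearly. Applying this to the inverse gives the other inequality. *)
Lemma bounded_group_sqr_det A : G A -> \det A ^+ 2 = 1.
Proof.
have [uG G1 GM GV [C GC]] := bG.
have det_le B : G B -> \det B ^+ 2 <= 1.
  move=> GB; rewrite -subr_le0.
  apply: (@bounded_multiples_le0 _ ((C * C + C * C) ^+ 2)) => k.
  have := bernoulli_ge k (sqr_ge0 (\det B)).
  rewrite -exprM mulnC exprM.
  have -> : \det B ^+ k = \det (B ^+ k).
    elim: k => [|k IH]; first by rewrite !expr0 det1.
    by rewrite !exprS IH -det_mulmx.
  have /GC := bounded_group_power k GB.
  rewrite [B ^+ k]mx2E det_mx2 => h.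
  have := h 0 0; have := h 0 1; have := h 1 0; have := h 1 1.
  rewrite !mxE /= => h1 h2 h3 h4.
  set D := (X in _ <= X ^+ 2) => hD.
  have DC : `|D| <= C * C + C * C.
    apply: (le_trans (ler_normB _ _)); rewrite !normrM.
    by apply: lerD; apply: ler_pM.
  have : D ^+ 2 <= (C * C + C * C) ^+ 2.
    by rewrite -real_normK ?num_real// ler_pXn2r ?nnegrE// (le_trans _ DC).
  by apply: le_trans; apply: le_trans hD; rewrite lerDr.
move=> GA; apply/eqP; rewrite eq_le det_le//=.
have := det_le _ (GV _ GA); rewrite det_inv exprVn invf_le1//.
by rewrite exprn_even_gt0//= -unitfE -unitmxE; exact: uG.
Qed.

(** By Cayley-Hamilton, squaring a matrix of determinant 1 sends its trace [t] to [t ^+ 2 - 2], so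
    any excess over 2 grows without bound under iterated squaring. *)
Lemma bounded_group_trace_le2 A : G A -> \det A = 1 -> `|\tr A| <= 2.
Proof.
have [uG G1 GM GV [C GC]] := bG.
have tr2 (B : 'M[R]_2) : \det B = 1 -> \tr (B *m B) = \tr B ^+ 2 - 2.
  by rewrite [B]mx2E det_mx2 mul_mx2 !trace_mx2 => E; move: E; nra.
have grow k : forall B e, G B -> \det B = 1 -> 0 <= e -> \tr B = 2 + e ->
    exists2 B', G B' & 2 + k.+1%:R * e <= \tr B'.
  elim: k => [|k IH] B e GB dB e0 tB; first by exists B; rewrite // mul1r tB.
  (* The excess after one squaring: [(2 + e) ^+ 2 - 2 = 2 + (4 * e + e ^+ 2)]. *)
  have [|||B' GB' hB'] := IH (B *m B) (4 * e + e ^+ 2) (GM _ _ GB GB).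
  - by rewrite det_mulmx dB mulr1.
  - by rewrite addr_ge0 ?sqr_ge0// mulr_ge0.
  - by rewrite tr2// tB; ring.
  exists B' => //; apply: le_trans hB'; rewrite lerD2l.
  have : 0 <= k%:R * e by rewrite mulr_ge0.
  have : 0 <= k.+1%:R * e ^+ 2 by rewrite mulr_ge0 ?sqr_ge0.
  by rewrite -!natr1; set y := k%:R; nra.
move=> GA dA; rewrite -ler_sqr ?nnegrE// real_normK ?num_real//.
rewrite -subr_le0; apply: wlog_neg => /negP; rewrite -ltNge => /ltW e0.
apply: (@bounded_multiples_le0 _ (C + C)) => k.
(* The iteration starts at [A *m A], whose trace [2 + (\tr A ^+ 2 - 4)] does not depend on the sign
   of [\tr A]. *)
have [||B GB hB] := grow k _ _ (GM _ _ GA GA) _ e0.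
- by rewrite det_mulmx dA mulr1.
- by rewrite tr2//; ring.
have tB : \tr B <= C + C.
  rewrite /mxtrace !big_ord_recl big_ord0 addr0.
  by apply: lerD; apply: le_trans (ler_norm _) _; exact: GC.
apply: le_trans tB; apply: le_trans hB; apply: ler_wpDl => //.
by apply: ler_wpM2r => //; rewrite ler_nat.
Qed.

Lemma bounded_group_lower_unipotent r : G (mx2 1 0 r 1) -> r = 0.
Proof.
have [uG G1 GM GV [C GC]] := bG => Gr.
have Gk k : G (mx2 1 0 (k%:R * r) 1).
  elim: k => [|k IH]; first by rewrite mul0r -scalar_mx2.
  have := GM _ _ IH Gr; rewrite mul_mx2; congr (G (mx2 _ _ _ _)); rewrite -?natr1; ring.
apply: le_anti; apply/andP; split.
  apply: (@bounded_multiples_le0 _ C) => k.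
  by have := GC _ (Gk k) 1 0; rewrite mxE/=; apply: le_trans; exact: ler_norm.
rewrite -oppr_le0; apply: (@bounded_multiples_le0 _ C) => k.
have := GC _ (Gk k) 1 0; rewrite mxE/=; apply: le_trans.
by rewrite -normrN mulrN; exact: ler_norm.
Qed.

(** The square of the matrix has determinant [p ^+ 2 * s ^+ 2 = 1] and trace [p ^+ 2 + s ^+ 2 <= 2],
    which is the equality case of the arithmetic-geometric mean inequality. *)
Lemma bounded_group_diag p s : G (mx2 p 0 0 s) -> p ^+ 2 = 1 /\ s ^+ 2 = 1.
Proof.
have [uG G1 GM GV _] := bG => Gps.
have dd : \det (mx2 p 0 0 s *m mx2 p 0 0 s) = 1.
  by rewrite det_mulmx -expr2 (bounded_group_sqr_det Gps).
have t2 : p ^+ 2 + s ^+ 2 <= 2.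
  have := bounded_group_trace_le2 (GM _ _ Gps Gps) dd.
  rewrite mul_mx2 trace_mx2 mul0r addr0 add0r -!expr2.
  by apply: le_trans; exact: ler_norm.
have := bounded_group_sqr_det Gps; rewrite det_mx2 mul0r subr0 => d2.
rewrite exprMn in d2.
have : (p ^+ 2 - s ^+ 2) ^+ 2 <= 0 by have := sqr_ge0 p; have := sqr_ge0 s; nra.
rewrite le_eqVlt ltNge sqr_ge0 orbF sqrf_eq0 subr_eq0 => /eqP ps.
rewrite -ps in d2 t2 *; suff -> : p ^+ 2 = 1 by [].
by have := sqr_ge0 p; nra.
Qed.

End in_bounded_group.
End bounded_groups.

(** * Bounded groups stable under conjugation by dilations, shears and rotations *)

Section jordan_conjugation.
Context {R : realType}.
Implicit Types (G : set 'M[R]_2) (A : 'M[R]_2) (p q r s x u v a b : R).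

(** Unbounded factors [x] force [q = 0]. The conjugate times the inverse is then lower unipotent
    with corner [r / p * (x^-1 - 1)], so [r = 0] because [x] is not 1. *)
Lemma bounded_group_diag_conj_large G : bounded_group G ->
  (forall K, exists x, [/\ K < x, 1 < x &
    forall p q r s, G (mx2 p q r s) -> G (mx2 p (q * x) (r / x) s)]) ->
  forall A, G A -> exists p s, [/\ A = mx2 p 0 0 s, p ^+ 2 = 1 & s ^+ 2 = 1].
Proof.
move=> bG conj; have [uG G1 GM GV [C GC]] := bG.
have upper0 p q r s : G (mx2 p q r s) -> q = 0.
  move=> GA; apply/eqP; apply: contrapT => /negP q0.
  have q0' : 0 < `|q| by rewrite normr_gt0.
  have [x [Kx x1 cx]] := conj (C / `|q|).
  have := GC _ (cx _ _ _ _ GA) 0 1; rewrite mxE /= normrM.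
  rewrite (gtr0_norm (lt_trans ltr01 x1)); apply/negP.
  by rewrite -ltNge mulrC -ltr_pdivrMr.
have [x [_ x1 cx]] := conj 0.
have x0 : x != 0 by rewrite gt_eqF// (lt_trans ltr01).
move=> A; rewrite [A]mx2E; move: (A 0 0) (A 0 1) (A 1 0) (A 1 1) => p q r s GA.
have q0 := upper0 _ _ _ _ GA; rewrite {}q0 in GA *.
have := cx _ _ _ _ GA; rewrite mul0r => GA'.
have ps : p * s - 0 * r != 0.
  by have := uG _ GA; rewrite unitmxE det_mx2 unitfE.
have [p0 s0] : p != 0 /\ s != 0.
  by move: ps; rewrite mul0r subr0 mulf_eq0 negb_or => /andP.
have := GM _ _ GA' (GV _ GA); rewrite invmx_mx2// -scalemxAr mul_mx2 scale_mx2.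
have -> : mx2 ((p * s - 0 * r)^-1 * (p * s + 0 * - r))
    ((p * s - 0 * r)^-1 * (p * - 0 + 0 * p))
    ((p * s - 0 * r)^-1 * (r / x * s + s * - r))
    ((p * s - 0 * r)^-1 * (r / x * - 0 + s * p)) =
    mx2 1 0 (r / p * (x^-1 - 1)) 1.
  by rewrite mul0r subr0; congr mx2; field; rewrite ?p0 ?s0 ?x0.
move=> /(bounded_group_lower_unipotent bG)/eqP.
rewrite mulf_eq0 mulf_eq0 invr_eq0 (negbTE p0) orbF subr_eq0.
have -> : (x^-1 == 1) = false by rewrite invr_eq1 gt_eqF.
rewrite orbF => /eqP r0; rewrite r0 in GA *.
by exists p, s; have [] := bounded_group_diag bG GA.
Qed.

Lemma bounded_group_diag_conj_small G : bounded_group G ->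
  (forall K, exists x, [/\ K < x, 1 < x &
    forall p q r s, G (mx2 p q r s) -> G (mx2 p (q / x) (r * x) s)]) ->
  forall A, G A -> exists p s, [/\ A = mx2 p 0 0 s, p ^+ 2 = 1 & s ^+ 2 = 1].
Proof.
move=> bG conj A GA.
have [||p [s [E p1 s1]]] := @bounded_group_diag_conj_large _
    (bounded_group_tr bG) _ A^T.
- move=> K; have [x [Kx x1 cx]] := conj K; exists x; split=> // p q r s.
  by rewrite /= !tr_mx2; exact: cx.
- by rewrite /= trmxK.
by exists p, s; split=> //; rewrite -[A]trmxK E tr_mx2.
Qed.

(** The hypothesis is conjugation by the lower shear with parameter [x]. The upper left entry is
    affine in [x], which gives [q = 0]; the lower left entry is then affine too, which gives
    [s = p]. Finally the square of the matrix is unipotent with corner [2 * p * r]. *)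
Lemma bounded_group_shear_conj G : bounded_group G ->
  (forall K, exists x, K < x /\ forall p q r s, G (mx2 p q r s) ->
    G (mx2 (p + q * x) q (r + (s - p) * x - q * x ^+ 2) (s - q * x))) ->
  forall A, G A -> A = 1%:M \/ A = - 1%:M.
Proof.
move=> bG conj; have [uG G1 GM GV [C GC]] := bG.
have affine0 (a b : R) : (forall K, exists2 x, K < x & `|a + b * x| <= C) -> b = 0.
  move=> h; apply/eqP; apply: contrapT => /negP b0.
  have b0' : 0 < `|b| by rewrite normr_gt0.
  have [x Kx] := h (`|(C + `|a|) / `|b| |).
  have x0 : 0 < x by apply: le_lt_trans Kx.
  apply/negP; rewrite -ltNge.
  have : (C + `|a|) / `|b| < x by apply: le_lt_trans Kx; exact: ler_norm.
  rewrite ltr_pdivrMr// => Cx.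
  have : `|b * x| <= `|a + b * x| + `|a|.
    by rewrite -{1}[b * x](addKr a) addrC (le_trans (ler_normD _ _))// normrN.
  rewrite normrM (gtr0_norm x0) => h1; rewrite -(ltrD2r `|a|).
  by apply: lt_le_trans h1; rewrite mulrC.
move=> A; rewrite [A]mx2E; move: (A 0 0) (A 0 1) (A 1 0) (A 1 1) => p q r s GA.
have q0 : q = 0.
  apply: (affine0 p) => K; have [x [Kx cx]] := conj K; exists x => //.
  by have := GC _ (cx _ _ _ _ GA) 0 0; rewrite mxE.
rewrite q0 in GA *; have sp : s - p = 0.
  apply: (affine0 r) => K; have [x [Kx cx]] := conj K; exists x => //.
  by have := GC _ (cx _ _ _ _ GA) 1 0; rewrite mxE /= mul0r subr0.
have {sp} sp : s = p by apply/eqP; rewrite -subr_eq0 sp.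
rewrite sp in GA *; have := bounded_group_sqr_det bG GA.
rewrite det_mx2 mul0r subr0 => p4.
have p2 : p ^+ 2 = 1.
  move/eqP: p4; rewrite sqrf_eq1 -expr2 => /orP[/eqP//|/eqP pN1].
  by have := sqr_ge0 p; rewrite pN1 oppr_ge0 ler10.
have p0 : p != 0 by apply: contra_eq_neq p2 => ->; rewrite expr0n/= eq_sym oner_eq0.
have := GM _ _ GA GA; rewrite mul_mx2 !mul0r !mulr0 !addr0 add0r -!expr2 p2.
move=> /(bounded_group_lower_unipotent bG)/eqP.
have -> : r * p + p * r = 2 * p * r by ring.
rewrite !mulf_eq0 (negbTE p0) pnatr_eq0/= => /eqP ->.
move: p2 => /eqP; rewrite sqrf_eq1 => /orP[]/eqP ->; [left|right].
- by rewrite scalar_mx2.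
- by rewrite scalar_mx2 opp_mx2 oppr0.
Qed.

Lemma unit_circle_angle x y : x ^+ 2 + y ^+ 2 = 1 ->
  exists2 t, 0 <= t < 2 * pi & cos t = x /\ sin t = y.
Proof.
move=> xy; have x1 : -1 <= x <= 1.
  by have := sqr_ge0 y => y0; apply/andP; split; nra.
have sq : Num.sqrt (1 - x ^+ 2) = `|y| by rewrite -xy addrC addKr sqrtr_sqr.
have pi0 := pi_gt0 R; have [y0|y0] := lerP 0 y.
  exists (acos x); last by rewrite acosK// sin_acos// sq ger0_norm.
  rewrite acos_ge0//= (le_lt_trans (acos_lepi x1))// -subr_gt0.
  by have -> : 2 * pi - pi = pi :> R by ring.
(* As [y] is negative, [x] differs from 1, so [acos x] is positive and the angle [2 * pi - acos x]
   stays below [2 * pi]. *)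
have x1' : -1 < x < 1 by have := xy; apply: contraPT; rewrite negb_and -!leNgt => /orP[|] ?; nra.
have x_lt1 : -1 <= x < 1 by apply/andP; split; [case/andP: x1|case/andP: x1'].
have acos0 := acos_gt0 x_lt1; have acospi := acos_lepi x1.
exists (2 * pi - acos x); first by apply/andP; split; lra.
rewrite cosB sinB acosK// sin_acos// sq ltr0_norm// mulr_natl cos2pi sin2pi.
by split; ring.
Qed.

(** In complex notation the matrix is [z |-> alpha z + beta conj z] with [alpha = u + i v] and
    [beta = a + i b]. Conjugation by the rotation fixes [alpha] and multiplies [beta] by
    [e^(-2 i phi)]. *)
Lemma rot_conj_mx2 phi u v a b :
  rot (- phi) *m mx2 (u + a) (b - v) (b + v) (u - a) *m rot phi =
  let a' := a * cos (phi *+ 2) + b * sin (phi *+ 2) in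
  let b' := b * cos (phi *+ 2) - a * sin (phi *+ 2) in
  mx2 (u + a') (b' - v) (b' + v) (u - a').
Proof.
have cs := cos2Dsin2 phi.
rewrite /rot cosN sinN !mul_mx2 !mulr2n cosD sinD /=.
move: (cos phi) (sin phi) cs => c s cs.
rewrite -[u in RHS]mulr1 -[v in RHS]mulr1 -cs.
by congr mx2; ring.
Qed.

(** With [alpha] and [beta] as above, the determinant is [|alpha|^2 - |beta|^2]. Determinant 1 must
    give [beta = 0], a rotation, and determinant -1 must give [alpha = 0], a reflection; the second
    case reduces to the first by taking products. *)
Lemma bounded_group_rot_conj G phi : bounded_group G -> cos (phi *+ 2) != 1 ->
  (forall A, G A -> G (rot (- phi) *m A *m rot phi)) -> G `<=` O2.
Proof.
move=> bG phi1 conj A; have [uG G1 GM GV _] := bG.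
have C1 : cos (phi *+ 2) < 1 by rewrite lt_neqAle phi1 cos_le1.
have CS := cos2Dsin2 (phi *+ 2).
have conj' u v a b := rot_conj_mx2 phi u v a b.
move: (cos (phi *+ 2)) (sin (phi *+ 2)) => C S in C1 CS phi1 conj'.
have {}conj u v a b : G (mx2 (u + a) (b - v) (b + v) (u - a)) ->
    let a' := a * C + b * S in let b' := b * C - a * S in
    G (mx2 (u + a') (b' - v) (b' + v) (u - a')).
  by move=> /conj; rewrite conj'.
have lin_part0 u v a b : G (mx2 (u + a) (b - v) (b + v) (u - a)) ->
    u ^+ 2 + v ^+ 2 - (a ^+ 2 + b ^+ 2) = 1 -> a = 0 /\ b = 0.
  move=> GA d1; have GA' := conj _ _ _ _ GA.
  have dA : (u + a) * (u - a) - (b - v) * (b + v) = 1 by rewrite -d1; ring.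
  (* This product has determinant 1 and trace [2 + 2 |beta|^2 (1 - C)], so the trace bound kills
     [beta]. *)
  have := GM _ _ GA' (GV _ GA).
  rewrite invmx_mx2 dA ?oner_neq0// invr1 scale1r mul_mx2.
  move=> /(bounded_group_trace_le2 bG); rewrite det_mx2 trace_mx2.
  set D := (X in X = 1 -> _); set T := (X in `|X|).
  have -> : D = ((u + a) * (u - a) - (b - v) * (b + v)) *
      (u ^+ 2 + v ^+ 2 - (C ^+ 2 + S ^+ 2) * (a ^+ 2 + b ^+ 2)).
    by rewrite /D; ring.
  rewrite dA CS !mul1r => /(_ d1) /(le_trans (ler_norm _)).
  have -> : T = 2 * (u ^+ 2 + v ^+ 2 - (a ^+ 2 + b ^+ 2) * C).
    by rewrite /T; ring.
  move=> T2; have : a ^+ 2 + b ^+ 2 <= 0.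
    have : (a ^+ 2 + b ^+ 2) * (1 - C) <= 0 by lra.
    by rewrite pmulr_lle0// subr_gt0.
  by have := sqr_ge0 a; have := sqr_ge0 b => b2 a2 ab; split; apply/eqP;
    rewrite -sqrf_eq0; apply/eqP; lra.
rewrite [A]mx2E; set u := (A 0 0 + A 1 1) / 2; set v := (A 1 0 - A 0 1) / 2.
set a := (A 0 0 - A 1 1) / 2; set b := (A 1 0 + A 0 1) / 2.
have -> : mx2 (A 0 0) (A 0 1) (A 1 0) (A 1 1) =
    mx2 (u + a) (b - v) (b + v) (u - a).
  by congr mx2; rewrite /u /v /a /b; field.
move: u v a b => u v a b GA.
have := bounded_group_sqr_det bG GA; rewrite det_mx2.
have -> : (u + a) * (u - a) - (b - v) * (b + v) =
  u ^+ 2 + v ^+ 2 - (a ^+ 2 + b ^+ 2) by ring.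
move=> /eqP; rewrite sqrf_eq1 => /orP[]/eqP d1.
  have [a0 b0] := lin_part0 _ _ _ _ GA d1; rewrite a0 b0 in d1 *.
  have [|t tpi [ct st]] := @unit_circle_angle u v; first by rewrite -d1; ring.
  by exists t; split=> //; left; rewrite /rot ct st; congr mx2; ring.
have ab0 : 0 < a ^+ 2 + b ^+ 2.
  by have := sqr_ge0 u; have := sqr_ge0 v; lra.
(* The square of the matrix has determinant 1 and antilinear part [2 u beta], while [beta] is
   nonzero. *)
have u0 : u = 0.
  have [||a0 b0] := lin_part0 (u ^+ 2 - v ^+ 2 + a ^+ 2 + b ^+ 2) (2 * u * v)
      (2 * u * a) (2 * u * b).
  - by have := GM _ _ GA GA; rewrite mul_mx2; congr (G (mx2 _ _ _ _)); ring.
  - transitivity ((u ^+ 2 + v ^+ 2 - (a ^+ 2 + b ^+ 2)) ^+ 2); first by ring.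
    by rewrite d1 sqrrN expr1n.
  have : 2 * u * (a ^+ 2 + b ^+ 2) = 0.
    transitivity (2 * u * a * a + 2 * u * b * b); first by ring.
    by rewrite a0 b0 !mul0r addr0.
  by move=> /eqP; rewrite mulf_eq0 (gt_eqF ab0) orbF mulf_eq0 pnatr_eq0 => /eqP.
rewrite u0 in GA d1 *.
(* With [u = 0], the product of the matrix and its conjugate has determinant 1 and antilinear part
   [i v (beta' - beta)]; the rotated [beta'] differs from [beta] because [C < 1]. *)
have v0 : v = 0.
  pose a' := a * C + b * S; pose b' := b * C - a * S.
  have [||va vb] := lin_part0 (a * a' + b * b' - v ^+ 2) (b * a' - a * b')
      (b * v - v * b') (v * a' - a * v).
  - by have := GM _ _ GA (conj _ _ _ _ GA); rewrite mul_mx2 /= -/a' -/b';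
      congr (G (mx2 _ _ _ _)); ring.
  - transitivity ((v ^+ 2 - (a ^+ 2 + b ^+ 2)) *
        (v ^+ 2 - (a' ^+ 2 + b' ^+ 2))); first by ring.
    have -> : a' ^+ 2 + b' ^+ 2 = (C ^+ 2 + S ^+ 2) * (a ^+ 2 + b ^+ 2).
      by rewrite /a' /b'; ring.
    have {}d1 : v ^+ 2 - (a ^+ 2 + b ^+ 2) = -1 by rewrite -d1; ring.
    by rewrite CS mul1r d1; ring.
  have : v * ((a ^+ 2 + b ^+ 2) * (1 - C)) = 0.
    transitivity (b * (b * v - v * b') - a * (v * a' - a * v)).
      by rewrite /a' /b'; ring.
    by rewrite va vb !mulr0 subr0.
  by move=> /eqP; rewrite !mulf_eq0 (gt_eqF ab0) subr_eq0 (gt_eqF C1) !orbF => /eqP.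
rewrite v0 in d1 *; have [|t tpi [ct st]] := @unit_circle_angle a b.
  by apply: oppr_inj; rewrite -d1; ring.
by exists t; split=> //; right; rewrite /refl ct st; congr mx2; ring.
Qed.

End jordan_conjugation.

(** * Exponentials of the Jordan forms *)

Section matrix_exponential.
Context {R : realType}.
Implicit Types (a b c d x y t L : R).

Lemma mx2_cvg (u v w z : nat -> R) a b c d :
  u @ \oo --> a -> v @ \oo --> b -> w @ \oo --> c -> z @ \oo --> d ->
  mx2 (u n) (v n) (w n) (z n) @[n --> \oo] --> mx2 a b c d.
Proof.
have E p q r s : mx2 p q r s = p *: mx2 1 0 0 0 + q *: mx2 0 1 0 0 +
    (r *: mx2 0 0 1 0 + s *: mx2 0 0 0 1).
  apply/matrixP => i j; rewrite !mxE; have [->|->] := ord2P i;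
  have [->|->] := ord2P j; rewrite /= ?mulr0 ?mulr1 ?addr0 ?add0r//.
move=> ua vb wc zd; under eq_cvg do rewrite E.
by rewrite E; apply: cvgD; apply: cvgD; apply: cvgZ => //; exact: cvg_cst.
Qed.

Lemma mexp_mx2 (A : 'M[R]_2) (u v w z : nat -> R) a b c d :
  (forall k, A ^+ k = mx2 (u k) (v k) (w k) (z k)) ->
  series (fun k => u k / k`!%:R) @ \oo --> a ->
  series (fun k => v k / k`!%:R) @ \oo --> b ->
  series (fun k => w k / k`!%:R) @ \oo --> c ->
  series (fun k => z k / k`!%:R) @ \oo --> d ->
  mexp A = mx2 a b c d.
Proof.
move=> Ak ua vb wc zd; apply: cvg_lim => //.
suff -> : (fun n => \sum_(0 <= k < n) (k`!%:R)^-1 *: A ^+ k) =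
  (fun n => mx2 (series (fun k => u k / k`!%:R) n)
    (series (fun k => v k / k`!%:R) n) (series (fun k => w k / k`!%:R) n)
    (series (fun k => z k / k`!%:R) n)) by exact: mx2_cvg.
apply/funext => n; apply/matrixP => i j; rewrite summxE mxE.
by have [->|->] := ord2P i; have [->|->] := ord2P j;
  apply: eq_bigr => k _; rewrite Ak !mxE mulrC.
Qed.

Lemma series_expR x :
  series (fun k => x ^+ k / k`!%:R) @ \oo --> expR x.
Proof. exact: is_cvg_series_exp_coeff. Qed.

Lemma cvg_series0 : series (fun k => 0 / k`!%:R : R) @ \oo --> (0 : R).
Proof.
have -> : (fun k => 0 / k`!%:R : R) = (fun=> 0).
  by apply/funext => k; rewrite mul0r.
rewrite (_ : series _ = fun=> 0); first exact: cvg_cst.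
by apply/funext => n; rewrite /series /= big1.
Qed.

Lemma mexp_diag a b : mexp (mx2 a 0 0 b) = mx2 (expR a) 0 0 (expR b).
Proof.
apply: (@mexp_mx2 _ (fun k => a ^+ k) (fun=> 0) (fun=> 0) (fun k => b ^+ k)).
- elim=> [|k IH]; first by rewrite !expr0; exact: scalar_mx2.
  rewrite exprS IH; apply: (etrans (mul_mx2 _ _ _ _ _ _ _ _)).
  by rewrite !exprS !mulr0 !mul0r !addr0 add0r.
- exact: series_expR.
- exact: cvg_series0.
- exact: cvg_series0.
- exact: series_expR.
Qed.

Lemma mexp_lower x y :
  mexp (mx2 x 0 y x) = mx2 (expR x) 0 (y * expR x) (expR x).
Proof.
(* The corner of the [k]-th power is the derivative [k x^(k-1)] times [y]; at [k = 0] the truncated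
   predecessor is harmless because of the factor [k%:R]. *)
apply: (@mexp_mx2 _ (fun k => x ^+ k) (fun=> 0)
    (fun k => y * (k%:R * x ^+ k.-1)) (fun k => x ^+ k)).
- elim=> [|k IH].
    by rewrite !expr0 mul0r mulr0; exact: scalar_mx2.
  rewrite exprS IH; apply: (etrans (mul_mx2 _ _ _ _ _ _ _ _)).
  rewrite !mulr0 !mul0r !addr0 add0r -!exprS; congr mx2.
  rewrite -natr1 /=; case: k {IH} => [|k]; first by rewrite expr0; ring.
  by rewrite /= !exprS; ring.
- exact: series_expR.
- exact: cvg_series0.
- rewrite -cvg_shiftS.
  rewrite (_ : (fun n => _) = (fun n => y * series (fun k => x ^+ k / k`!%:R) n)).
    by apply: cvgM; [exact: cvg_cst|exact: series_expR].
  apply/funext => n; rewrite /series /= big_nat_recl//= !mul0r mulr0 mul0r add0r.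
  rewrite mulr_sumr; apply: eq_bigr => k _; rewrite factS natrM -mulrA; congr (_ * _).
  have k0 : k.+1%:R != 0 :> R by rewrite pnatr_eq0.
  have f0 : k`!%:R != 0 :> R by rewrite pnatr_eq0 -lt0n fact_gt0.
  by field; rewrite ?nat1r ?f0 ?k0.
- exact: series_expR.
Qed.

(** The exponential generating function of [w]; differentiating it shifts the sequence. *)
Definition genexp (w : nat -> R) t : R :=
  limn (pseries (fun k => w k / k`!%:R) t).

Definition subgeometric (w : nat -> R) :=
  exists D M, [/\ 0 <= D, 0 <= M & forall k, `|w k| <= D * M ^+ k].

Lemma subgeometricS w : subgeometric w -> subgeometric (fun k => w k.+1).
Proof.
move=> [D [M [D0 M0 wDM]]]; exists (D * M), M; split=> //.
  exact: mulr_ge0.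
by move=> k; rewrite -mulrA -exprS.
Qed.

Lemma genexp_cvg w t : subgeometric w ->
  cvgn (pseries (fun k => w k / k`!%:R) t).
Proof.
move=> [D [M [D0 M0 wDM]]]; apply: normed_cvg.
apply: (@series_le_cvg _ _ (D *: exp_coeff (M * `|t|))) => [k|k|k|].
- exact: normr_ge0.
- by rewrite mulr_ge0// exp_coeff_ge0// mulr_ge0.
- have -> : (D *: exp_coeff (M * `|t|)) k = D * (M ^+ k * `|t| ^+ k / k`!%:R).
    by rewrite -exprMn.
  rewrite /= !normrM normfV normrX normr_nat.
  have := ler_pM (normr_ge0 _) _ (wDM k) (lexx (`|t| ^+ k / k`!%:R)).
  have -> : `|w k| * (`|t| ^+ k / k`!%:R) = `|w k| / k`!%:R * `|t| ^+ k by ring.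
  have -> : D * M ^+ k * (`|t| ^+ k / k`!%:R) = D * (M ^+ k * `|t| ^+ k / k`!%:R).
    by ring.
  by apply; rewrite divr_ge0// exprn_ge0.
- by apply: is_cvg_seriesZ; exact: is_cvg_series_exp_coeff.
Qed.

(** Termwise differentiation needs the series and its first two formal derivatives to converge at a
    point beyond [|t|]; geometric growth survives shifting, so all three do. *)
Lemma genexp_derive w t : subgeometric w ->
  is_derive t (1 : R) (genexp w) (genexp (fun k => w k.+1) t).
Proof.
move=> ws.
have D v : pseries_diffs (fun k => v k / k`!%:R) = (fun k => v k.+1 / k`!%:R).
  apply/funext => k; rewrite /pseries_diffs factS natrM.
  by rewrite invfM mulrCA mulVKf ?pnatr_eq0.
have := @pseries_snd_diffs R (fun k => w k / k`!%:R) (`|t| + 1) t.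
rewrite !D; apply.
- exact: genexp_cvg.
- by apply: genexp_cvg; exact: subgeometricS.
- by apply: genexp_cvg; exact: (subgeometricS (subgeometricS ws)).
- by rewrite [ltRHS]ger0_norm ?addr_ge0// ltrDl.
Qed.

Lemma genexp0 w : genexp w 0 = w 0%N.
Proof.
apply: cvg_lim => //; rewrite -cvg_shiftS.
rewrite (_ : (fun n => _) = (fun=> w 0%N)); first exact: cvg_cst.
apply/funext => n; rewrite /pseries /series /= big_nat_recl// big1 => [|k _].
  by rewrite expr0 fact0; field.
by rewrite expr0n /= mulr0.
Qed.

Lemma genexp_lin w1 w2 a b t : subgeometric w1 -> subgeometric w2 ->
  genexp (fun k => a * w1 k + b * w2 k) t = a * genexp w1 t + b * genexp w2 t.
Proof.
move=> s1 s2; apply: cvg_lim => //.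
rewrite (_ : pseries _ t = fun n => a * pseries (fun k => w1 k / k`!%:R) t n +
    b * pseries (fun k => w2 k / k`!%:R) t n); last first.
  apply/funext => n; rewrite /pseries /series /= !mulr_sumr -big_split/=.
  by apply: eq_bigr => k _; ring.
apply: cvgD; apply: cvgM; [exact: cvg_cst| |exact: cvg_cst|].
- by rewrite /genexp; exact: genexp_cvg.
- by rewrite /genexp; exact: genexp_cvg.
Qed.

(* With [f + i g] the series of [exp (t (x + i y))], the functions below are the
   real and imaginary parts of [exp (- t (x + i y)) (f + i g)]; they satisfy
   [h' = 0]. *)
Lemma mexp_rot x y : mexp (mx2 x (- y) y x) = expR x *: rot y.
Proof.
pose A : 'M[R]_2 := mx2 x (- y) y x.
pose re k := (A ^+ k) 0 0; pose im k := (A ^+ k) 1 0.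
have Ak k : A ^+ k = mx2 (re k) (- im k) (im k) (re k) /\
    (re k.+1 = x * re k + - y * im k /\ im k.+1 = y * re k + x * im k).
  have S B k' : A ^+ k' = B -> A ^+ k'.+1 = A *m B by move=> <-; rewrite exprS.
  have rec k' : A ^+ k' = mx2 (re k') (- im k') (im k') (re k') ->
      re k'.+1 = x * re k' + - y * im k' /\ im k'.+1 = y * re k' + x * im k'.
    by move=> /S; rewrite /A mul_mx2 -/A /re /im => ->; rewrite !mxE.
  suff E : A ^+ k = mx2 (re k) (- im k) (im k) (re k) by split=> //; exact: rec.
  elim: k => [|k IH].
    by rewrite /re /im !expr0 !mxE /= oppr0; exact: scalar_mx2.
  rewrite (S _ _ IH) /A mul_mx2; have [-> ->] := rec k IH; congr mx2; ring.
have bnd k : `|re k| <= (`|x| + `|y|) ^+ k /\ `|im k| <= (`|x| + `|y|) ^+ k.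
  elim: k => [|k [IHr IHi]].
    by rewrite /re /im !expr0 !mxE /= normr1 normr0 ler01.
  have [_ [-> ->]] := Ak k; split; apply: (le_trans (ler_normD _ _)).
  - rewrite !normrM normrN exprS mulrDl.
    by apply: lerD; apply: ler_wpM2l.
  - rewrite !normrM exprS [`|x| + _]addrC mulrDl.
    by apply: lerD; apply: ler_wpM2l => //; rewrite [_ + `|x|]addrC.
have sre : subgeometric re.
  by exists 1, (`|x| + `|y|); split=> // k; rewrite mul1r; case: (bnd k).
have sim : subgeometric im.
  by exists 1, (`|x| + `|y|); split=> // k; rewrite mul1r; case: (bnd k).
pose f := genexp re; pose g := genexp im.
have df t : is_derive t (1 : R) f (x * f t + - y * g t).
  rewrite -genexp_lin//; have := genexp_derive t sre.
  by congr is_derive; congr (genexp _ t); apply/funext => k; case: (Ak k) => _ [].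
have dg t : is_derive t (1 : R) g (y * f t + x * g t).
  rewrite -genexp_lin//; have := genexp_derive t sim.
  by congr is_derive; congr (genexp _ t); apply/funext => k; case: (Ak k) => _ [].
have dlin (z t : R) : is_derive t (1 : R) (fun s => z * s) z.
  have := @is_deriveZ _ _ _ id z t 1 1 (is_derive_id _ _).
  by rewrite /GRing.scale /= mulr1.
have dE t : is_derive t (1 : R) (fun s => expR (- x * s)) (- x * expR (- x * t)).
  by rewrite mulrC; exact: (is_derive1_comp (is_derive_expR _) (dlin (- x) t)).
have dC t : is_derive t (1 : R) (fun s => cos (y * s)) (- y * sin (y * t)).
  by rewrite mulrC mulrN -mulNr; exact: (is_derive1_comp (is_derive_cos _) (dlin y t)).
have dS t : is_derive t (1 : R) (fun s => sin (y * s)) (y * cos (y * t)).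
  by rewrite mulrC; exact: (is_derive1_comp (is_derive_sin _) (dlin y t)).
pose H := fun s => expR (- x * s) * (f s * cos (y * s) + g s * sin (y * s)).
pose K := fun s => expR (- x * s) * (g s * cos (y * s) - f s * sin (y * s)).
have dH t : is_derive t (1 : R) H 0.
  apply: (is_derive_eq (is_deriveM (dE t)
    (is_deriveD (is_deriveM (df t) (dC t)) (is_deriveM (dg t) (dS t))))).
  by rewrite !fctE /GRing.scale /=; ring.
have dK t : is_derive t (1 : R) K 0.
  apply: (is_derive_eq (is_deriveM (dE t)
    (is_deriveB (is_deriveM (dg t) (dC t)) (is_deriveM (df t) (dS t))))).
  by rewrite !fctE /GRing.scale /=; ring.
have H1 : H 1 = 1.
  rewrite (is_derive_0_is_cst 1 0 dH) /H !mulr0 expR0 cos0 sin0 /f genexp0.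
  by rewrite /re expr0 mxE/=; ring.
have K1 : K 1 = 0.
  rewrite (is_derive_0_is_cst 1 0 dK) /K !mulr0 expR0 cos0 sin0 /f /g !genexp0.
  by rewrite /re /im expr0 !mxE/=; ring.
have E0 : expR x * expR (- x) = 1 by rewrite -expRD subrr expR0.
have cs := cos2Dsin2 y.
(* The definition of [H] and [K] is inverted at time 1: [f + i g = e^(x + i y) (H + i K)]. *)
have f1 : f 1 = expR x * cos y.
  transitivity (expR x * (H 1 * cos y - K 1 * sin y)); last first.
    by rewrite H1 K1; ring.
  rewrite /H /K !mulr1; transitivity (expR x * expR (- x) *
    (f 1 * (cos y ^+ 2 + sin y ^+ 2))); last by ring.
  by rewrite E0 cs; ring.
have g1 : g 1 = expR x * sin y.
  transitivity (expR x * (K 1 * cos y + H 1 * sin y)); last first.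
    by rewrite H1 K1; ring.
  rewrite /H /K !mulr1; transitivity (expR x * expR (- x) *
    (g 1 * (cos y ^+ 2 + sin y ^+ 2))); last by ring.
  by rewrite E0 cs; ring.
have cv w : subgeometric w ->
    series (fun k => w k / k`!%:R) @ \oo --> genexp w 1.
  move=> sw; have := @genexp_cvg w 1 sw; rewrite /genexp /pseries.
  suff -> : series (fun k => w k / k`!%:R) =
    series (fun k => w k / k`!%:R * 1 ^+ k) by [].
  by congr series; apply/funext => k; rewrite expr1n mulr1.
rewrite /rot scale_mx2 mulrN -f1 -g1.
apply: (@mexp_mx2 _ re (fun k => - im k) im re) => //.
- by move=> k; case: (Ak k).
- exact: cv.
- rewrite (_ : series _ = fun n => - series (fun k => im k / k`!%:R) n).
    by apply: cvgN; exact: cv.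
  apply/funext => n; rewrite /series /= -sumrN.
  by apply: eq_bigr => k _; rewrite mulNr.
- exact: cv.
- exact: cv.
Qed.

End matrix_exponential.

(** * Rotations and reflections *)

Section rotations.
Context {R : realType}.
Implicit Types (s t a b : R) (G : set 'M[R]_2).

Lemma rotD s t : rot s *m rot t = rot (s + t).
Proof. by rewrite /rot mul_mx2 cosD sinD; congr mx2; ring. Qed.

Lemma rot0 : rot 0 = 1%:M :> 'M[R]_2.
Proof. by rewrite /rot cos0 sin0 oppr0 scalar_mx2. Qed.

Lemma rotNr t : rot (- t) *m rot t = 1%:M.
Proof. by rewrite rotD addNr rot0. Qed.

Lemma rot_unit t : rot t \in unitmx.
Proof. by have /mulmx1_unit[] := rotNr t. Qed.

Lemma invmx_rot t : invmx (rot t) = rot (- t).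
Proof.
by apply: (can_inj (mulKmx (rot_unit t))); rewrite mulmxV ?rot_unit// rotD
  subrr rot0.
Qed.

Lemma rot_mul_refl s t : rot s *m refl t = refl (s + t).
Proof. by rewrite /rot /refl mul_mx2 cosD sinD; congr mx2; ring. Qed.

Lemma refl_mul_refl s t : refl s *m refl t = rot (s - t).
Proof. by rewrite /rot /refl mul_mx2 cosB sinB; congr mx2; ring. Qed.

Lemma refl_conj s t : rot (- s) *m refl t *m rot s = refl (t - s *+ 2).
Proof.
rewrite rot_mul_refl /rot /refl mul_mx2.
have -> : t - s *+ 2 = - s + t - s by ring.
by rewrite [in RHS]cosB [in RHS]sinB; congr mx2; ring.
Qed.

Lemma rot_nat2pi (k : nat) : rot (k%:R * (2 * pi)) = 1%:M :> 'M[R]_2.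
Proof.
elim: k => [|k IH]; first by rewrite mul0r rot0.
rewrite -natr1 mulrDl mul1r -rotD IH mul1mx /rot mulr_natl cos2pi sin2pi oppr0.
by rewrite scalar_mx2.
Qed.

Lemma rot_int2pi (k : int) : rot (k%:~R * (2 * pi)) = 1%:M :> 'M[R]_2.
Proof.
case: k => k; first exact: rot_nat2pi.
by rewrite NegzE mulrNz mulNr -invmx_rot rot_nat2pi invmx1.
Qed.

(** Without arbitrarily small positive elements the subgroup has a least positive one, which
    generates it by Euclidean division; as [2 * pi] is a multiple of it, it equals [2 * pi / n]. *)
Lemma subgroup_cyclic_or_dense (T : set R) : T (2 * pi) ->
  (forall s t, T s -> T t -> T (s - t)) ->
  (forall e, 0 < e -> exists2 t, T t & 0 < t < e) \/
  exists2 n, (1 <= n)%N & forall t, T t <-> exists k : int,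
    t = k%:~R * (2 * pi / n%:R).
Proof.
move=> T2pi TB; have pi0 := pi_gt0 R.
have [dense|ndense] := pselect (forall e, 0 < e -> exists2 t, T t & 0 < t < e).
  by left.
right; move/existsNP: ndense => [e /not_implyP[e0 nT]].
have T0 : T 0 by rewrite -(subrr (2 * pi)); exact: TB.
have TN t : T t -> T (- t) by move=> Tt; rewrite -sub0r; exact: TB.
have TD s t : T s -> T t -> T (s + t).
  by move=> Ts /TN Tt; rewrite -[t]opprK; exact: TB.
have Tnat (k : nat) t : T t -> T (k%:R * t).
  move=> Tt; elim: k => [|k IH]; first by rewrite mul0r.
  by rewrite -natr1 mulrDl mul1r; exact: TD.
have Tint (k : int) t : T t -> T (k%:~R * t).
  move=> Tt; case: k => k; first exact: Tnat.
  by rewrite NegzE mulrNz mulNr; apply: TN; exact: Tnat.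
pose A := [set t | T t /\ 0 < t].
have hA : has_inf A.
  split; first by exists (2 * pi); split=> //; rewrite mulr_gt0.
  by exists 0 => t [_ /ltW].
(* An element within [e] of the infimum is already least: a smaller positive [t] would give the
   element [a - t] in the forbidden interval between 0 and [e]. *)
have [a [Ta a0] ale] := inf_adherent e0 hA.
have amin t : T t -> 0 < t -> a <= t.
  move=> Tt t0; rewrite leNgt; apply/negP => ta.
  apply: nT; exists (a - t); first exact: TB.
  rewrite subr_gt0 ta /= ltrBlDr (lt_le_trans ale)// addrC lerD2l.
  by apply: inf_lbound => //; case: hA.
have Tmul t : T t -> exists k : int, t = k%:~R * a.
  move=> Tt; exists (Num.floor (t / a)); apply/eqP; rewrite -subr_eq0.
  have Tr : T (t - (Num.floor (t / a))%:~R * a) by apply: TB => //; exact: Tint.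
  have r0 : 0 <= t - (Num.floor (t / a))%:~R * a.
    by rewrite subr_ge0 -ler_pdivlMr// Num.Theory.floor_le_tmp.
  have ra : t - (Num.floor (t / a))%:~R * a < a.
    have := Num.Theory.floorD1_gt (t / a).
    by rewrite ltr_pdivrMr// intrD mulrDl mul1r ltrBlDl.
  by move: r0; rewrite le_eqVlt eq_sym => /orP[//|/(amin _ Tr)]; rewrite leNgt ra.
have [k pik] := Tmul _ T2pi.
have k0 : 0 < k.
  have : 0 < k%:~R * a by rewrite -pik mulr_gt0.
  by rewrite pmulr_lgt0// ltr0z.
case: k k0 pik => // n n0 pik.
have n0' : n%:R != 0 :> R by rewrite pnatr_eq0; case: n n0 {pik}.
have an : a = 2 * pi / n%:R by rewrite pik -pmulrn mulrAC mulfV// mul1r.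
exists n; first by case: n n0 {pik n0' an}.
rewrite -an => t; split; first exact: Tmul.
by move=> [j ->]; exact: Tint.
Qed.

Lemma rotation_group_cyclic_or_dense G : bounded_group G -> G `<=` O2 ->
  (forall t, ~ G (refl t)) ->
  (forall e, 0 < e -> exists2 t, G (rot t) & 0 < t < e) \/
  exists2 n, (1 <= n)%N & G = Cgrp n.
Proof.
move=> [uG G1 GM GV _] GO2 noref.
have [||//|[n n1 Tn]] := @subgroup_cyclic_or_dense [set t | G (rot t)].
- by have := rot_nat2pi 1; rewrite /= mul1r => ->.
- move=> s t /= Gs /GV; rewrite invmx_rot => Gt.
  by change (G (rot (s - t))); rewrite -rotD; exact: GM.
- by left.
right; exists n => //.
have n0 : n%:R != 0 :> R by rewrite pnatr_eq0; case: n n1 {Tn}.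
apply/seteqP; split=> [A GA|_ [k kn <-]]; last first.
  by apply/Tn; exists k%:Z; rewrite -pmulrn; field.
have [t [_ [At|At]]] := GO2 _ GA; last by have := noref t; rewrite -At.
have /Tn[k tk] : G (rot t) by rewrite -At.
have nz : (n%:Z != 0)%R by case: n n1 {Tn n0 tk}.
have := modz_ge0 k nz; have := ltz_mod k nz; have := divz_eq k n.
case: (modz k n) => // r kE rn _; rewrite /= ltz_nat in rn.
exists r => //; rewrite At tk.
have -> : k%:~R * (2 * pi / n%:R) =
    (k %/ n)%Z%:~R * (2 * pi) + 2 * pi * r%:R / n%:R :> R.
  by rewrite [in LHS]kE intrD intrM -!pmulrn; field.
by rewrite -rotD rot_int2pi mul1mx.
Qed.

End rotations.

(** * Rotation invariant laws *)

Section rotation_invariance.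
Context {R : realType}.
Implicit Types (mu : probability 'cV[R]_2 R) (E : set 'cV[R]_2) (s t : R).

(** A law invariant under translation by [h] is invariant under all multiples of [h]. If a
    coordinate of [h] is nonzero, these multiples push every point out of any slab in that
    coordinate, so all such slabs are null, although they exhaust the space. *)
Lemma eq_in_law_shift_inj d (mu : probability 'cV[R]_d R) (x y : 'cV[R]_d) :
  eq_in_law (P := mu) (fun z => z + x) (fun z => z + y) -> x = y.
Proof.
move=> xy; apply/eqP; rewrite -subr_eq0; apply/eqP; set h := x - y.
have hz : eq_in_law (P := mu) (fun z => z + h) id.
  move=> E mE; have := eq_in_law_comp (measurable_addr (- y)) xy mE.
  rewrite /pushforward /= => e.
  transitivity (mu ((fun z => z + x - y) @^-1` E)).
    by congr (mu _); apply/seteqP; split=> z /=; rewrite addrA.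
  by rewrite e; congr (mu _); apply/seteqP; split=> z /=; rewrite addrK.
clearbody h; have kh k : eq_in_law (P := mu) (fun z => z + h *+ k) id.
  elim: k => [|k IH] E mE.
    by congr (mu _); apply/seteqP; split=> z /=; rewrite mulr0n addr0.
  have e := eq_in_law_comp (measurable_addr h) IH mE.
  apply: etrans (hz E mE); apply: etrans e.
  by congr (mu _); apply/seteqP; split=> z /=; rewrite mulrSr (addrA z).
apply/colP => i; rewrite mxE; pose v : 'rV[R]_d := delta_mx 0 i.
have vz (z : 'cV[R]_d) : (v *m z) 0 0 = z i 0 by rewrite /v -rowE mxE.
apply: contrapT => hi0. 
have null (K : nat) : mu [set z | `|(v *m z) 0 0 - 0| <= K%:R] = 0%E.
  apply/eqP; rewrite eq_le measure_ge0 andbT -(measure0 mu).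
  pose F k := (fun z : 'cV[R]_d => z + h *+ k) @^-1`
    [set z | `|(v *m z) 0 0 - 0| <= K%:R].
  apply: (@limsup_prob_ge _ _ _ mu F) => //.
  - move=> k; rewrite -[X in measurable X]setTI.
    by apply: measurable_addr => //; exact: slab_measurable.
  - by move=> k; rewrite (_ : mu (F k) = mu [set z | `|(v *m z) 0 0 - 0| <= K%:R]) ?lexx//;
    exact: (kh k _ (slab_measurable _ _ _)).
  - move=> z Fz; apply: hi0.
    have n0 : 0 <= K%:R + `|z i 0| by rewrite addr_ge0.
    have [k /= Bk] := Fz (Num.bound ((K%:R + `|z i 0|) / `|h i 0|)) I.
    rewrite /F /= subr0 vz !mxE mulmxnE => Fk.
    apply/normr0_eq0; apply: contrapT => /eqP hi.
    have {}hi : 0 < `|h i 0| by rewrite lt_neqAle eq_sym hi normr_ge0.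
    have := archi_boundP (divr_ge0 n0 (ltW hi)); rewrite ltr_pdivrMr// => lt1.
    have : `|h i 0| * k%:R <= K%:R + `|z i 0|.
      have -> : `|h i 0| * k%:R = `|z i 0 + h i 0 *+ k - z i 0|.
        by rewrite addrC addKr normrMn mulr_natr.
      by apply: le_trans (ler_normB _ _) _; rewrite lerD2r.
    apply/negP; rewrite -ltNge; apply: lt_le_trans lt1 _.
    by rewrite mulrC ler_pM2l// ler_nat.
have c1 := @slab_cvg1 _ _ mu v 0.
have c0 : mu [set z | `|(v *m z) 0 0 - 0| <= K%:R] @[K --> \oo] --> 0%E.
  rewrite (_ : (fun K : nat => mu [set z | `|(v *m z) 0 0 - 0| <= K%:R]) = fun=> 0%E).
    exact: cvg_cst.
  by apply/funext => K; exact: null.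
have e10 : (1 = 0 :> \bar R)%E.
  exact: (etrans (esym (cvg_lim (@ereal_hausdorff R) c1))
    (cvg_lim (@ereal_hausdorff R) c0)).
by move/eqP: e10; rewrite onee_eq0.
Qed.

Lemma rot_mulE t (z : 'cV[R]_2) :
  rot t *m z = cos t *: z + sin t *: (mx2 0 (- 1) 1 0 *m z).
Proof.
rewrite -[in X in X + _](mul1mx z) !scalemxAl -mulmxDl; congr (_ *m _).
rewrite scale_mx2; apply/matrixP => i j; rewrite /rot !mxE.
by have [->|->] := ord2P i; have [->|->] := ord2P j; rewrite /=; ring.
Qed.

(** Closed sets are stable under intersection and generate the Borel sets, so a probability is
    determined by them. *)
Lemma eq_in_law_closed d (mu : probability 'cV[R]_d R)
    (f g : 'cV[R]_d -> 'cV[R]_d) :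
  measurable_fun setT f -> measurable_fun setT g ->
  (forall K, closed K -> mu (f @^-1` K) = mu (g @^-1` K)) ->
  eq_in_law (P := mu) f g.
Proof.
move=> mf mg fgK E mE.
apply: (@measure_unique _ _ _ (@closed 'cV[R]_d) (fun=> setT) _ _ _ _
  (distribution mu (mfun_of mf)) (distribution mu (mfun_of mg))) => //.
- apply/seteqP; split; apply: smallest_sub; try exact: smallest_sigma_algebra.
  + move=> U /open_closedC cU; rewrite -[U]setCK; apply: sigma_algebraC.
    by apply: sub_sigma_algebra.
  + by move=> K cK; exact: closed_measurable_mx.
- by move=> A B; exact: closedI.
- by apply/seteqP; split=> // z _; exists 0%N.
- by move=> _; apply: (le_lt_trans (probability_le1 _ _)); rewrite ?ltry.
Qed.

Lemma measurable_rot t : measurable_fun setT (mulmx (rot t) : 'cV[R]_2 -> _).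
Proof. exact: measurable_mulmx. Qed.

Lemma matrix_cvg m n (T : Type) (F : set_system T) (FF : Filter F)
    (f : T -> 'M[R]_(m, n)) (M : 'M[R]_(m, n)) :
  (forall i j, f x i j @[x --> F] --> M i j) -> f x @[x --> F] --> M.
Proof.
move=> fM; apply/cvg_ballP => e e0.
apply: (@filterS _ F _ (fun x => forall i j, ball (M i j) e (f x i j))) => //.
by apply: filter_forall => i; apply: filter_forall => j; apply: cvg_ball.
Qed.

Lemma continuous_mulmx m n (A : 'M[R]_(m, n)) :
  continuous (mulmx A : 'cV[R]_n -> 'cV[R]_m).
Proof.
move=> z; apply: (@matrix_cvg m 1 _ (nbhs z) (nbhs_filter z)) => i j; rewrite mxE.
rewrite (_ : (fun x : 'cV[R]_n => (A *m x) i j) =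
    (fun x => \sum_k A i k * x k j)); last by apply/funext => x; rewrite mxE.
apply: cvg_big => [|k _]; first exact: add_continuous.
by apply: cvgM; [exact: cvg_cst|exact: coord_continuous].
Qed.

Lemma rot_mul_continuous (z : 'cV[R]_2) : continuous (fun t => rot t *m z).
Proof.
rewrite (_ : (fun t => rot t *m z) =
    fun t => cos t *: z + sin t *: (mx2 0 (- 1) 1 0 *m z)); last first.
  by apply/funext => t; rewrite rot_mulE.
move=> t; apply: cvgD; apply: cvgZ; try exact: cvg_cst.
- exact: continuous_cos.
- exact: continuous_sin.
Qed.

(** Invariance about the origin, with no shift allowed, unlike membership in [symmetry_group]. *)
Definition rotation_invariant mu :=
  forall t, eq_in_law (P := mu) (mulmx (rot t)) id.

(** Multiples of small angles approximate any [t]. For closed [K], a point sent into [K] by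
    infinitely many of the approximating rotations is sent into [K] by the limit, which gives one
    inequality; the rotation by [- t] gives the other. *)
Lemma rotation_invariant_dense mu :
  (forall t, symmetry_group mu (rot t) ->
    eq_in_law (P := mu) (mulmx (rot t)) id) ->
  (forall e, 0 < e -> exists2 t, symmetry_group mu (rot t) & 0 < t < e) ->
  rotation_invariant mu.
Proof.
move=> fix_S dense.
have approx t e : 0 < e -> exists s, symmetry_group mu (rot s) /\ `|t - s| < e.
  move=> /dense[s Ss /andP[s0 se]].
  have Snat (k : nat) : symmetry_group mu (rot (k%:R * s)).
    elim: k => [|k IH]; first by rewrite mul0r rot0; exact: symmetry_group1.
    by rewrite -natr1 mulrDl mul1r -rotD; exact: symmetry_groupM.
  have Sint (k : int) : symmetry_group mu (rot (k%:~R * s)).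
    case: k => k; first exact: Snat.
    by rewrite NegzE mulrNz mulNr -invmx_rot; apply: symmetry_groupV; exact: (Snat k.+1).
  exists ((Num.floor (t / s))%:~R * s); split; first exact: Sint.
  have nn : 0 <= t - (Num.floor (t / s))%:~R * s.
    by rewrite subr_ge0 -ler_pdivlMr// Num.Theory.floor_le_tmp.
  rewrite ger0_norm//; apply: lt_trans se; have := Num.Theory.floorD1_gt (t / s).
  by rewrite ltr_pdivrMr// intrD mulrDl mul1r ltrBlDl.
have le_closed t K : closed K -> (mu K <= mu (mulmx (rot t) @^-1` K))%E.
  move=> cK.
  have mrK s : measurable (mulmx (rot s) @^-1` K).
    rewrite -[X in measurable X]setTI; apply: measurable_rot => //.
    exact: closed_measurable_mx.
  have /choice[s hs] (n : nat) : exists s, symmetry_group mu (rot s) /\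
      `|t - s| < n.+1%:R^-1.
    by apply: approx; rewrite invr_gt0 ltr0n.
  have st : s @ \oo --> t.
    apply/cvgrPdist_lt => e e0; have [N _ Ne] := near_infty_natSinv_lt (PosNum e0).
    by exists N => // n /Ne; apply: lt_trans; case: (hs n).
  apply: (@limsup_prob_ge _ _ _ mu (fun n => mulmx (rot (s n)) @^-1` K)) => //.
  - move=> n; have [Ss _] := hs n.
    by have := fix_S _ Ss K (closed_measurable_mx cK); rewrite /pushforward => ->.
  - move=> z Fz /=; apply: contrapT => nK.
    have : \forall w \near rot t *m z, (~` K) w.
      by apply: open_nbhs_nbhs; split=> //; exact: closed_openC.
    move=> /(cvg_comp _ _ st (@rot_mul_continuous z t)) [N _ NK].
    by have [n /= Nn Kn] := Fz N I; exact: (NK n Nn).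
move=> t; apply: eq_in_law_closed => // [|K cK]; first exact: measurable_rot.
rewrite preimage_id; apply: le_anti; rewrite le_closed// andbT.
have cK' : closed (mulmx (rot t) @^-1` K : set 'cV[R]_2).
  by apply: preimage_closed => // z _; exact: continuous_mulmx.
apply: le_trans (le_closed (- t) _ cK') _; rewrite le_eqVlt; apply/orP; left.
apply/eqP; congr (mu _); apply/seteqP; split=> z /=;
  by rewrite mulmxA rotD subrr rot0 mul1mx.
Qed.

End rotation_invariance.

(** * From rotation invariance to a reflection *)

Section reflection_invariance.
Context {R : realType}.
Implicit Types (x y z : 'cV[R]_2) (E : set 'cV[R]_2).

Lemma measurable_mulmx_fun d (T : measurableType d) m n p
    (f : T -> 'M[R]_(m, n)) (g : T -> 'M[R]_(n, p)) :
  measurable_fun setT f -> measurable_fun setT g ->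
  measurable_fun setT (fun t => f t *m g t).
Proof.
move=> mf mg; apply: measurable_fun_mx => i j; under eq_fun do rewrite mxE.
apply: measurable_sum => k; apply: measurable_funM.
- exact: (measurableT_comp (measurable_coord i k) mf).
- exact: (measurableT_comp (measurable_coord k j) mg).
Qed.

Lemma product_measure_eq_xsection d1 d2 (T1 : measurableType d1)
    (T2 : measurableType d2) (m1 : probability T1 R) (m2 : probability T2 R)
    (A B : set (T1 * T2)) :
  (forall u, m2 (xsection A u) = m2 (xsection B u)) ->
  (m1 \x m2)%E A = (m1 \x m2)%E B.
Proof. by move=> AB; apply: eq_integral => u _ /=; exact: AB. Qed.

(** The product measure integrates x-sections by definition; y-sections are reached through the
    product with the opposite order of integration, which agrees with it on rectangles. *)
Lemma product_measure_eq_ysection d1 d2 (T1 : measurableType d1)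
    (T2 : measurableType d2) (m1 : probability T1 R) (m2 : probability T2 R)
    (A B : set (T1 * T2)) : measurable A -> measurable B ->
  (forall v, m1 (ysection A v) = m1 (ysection B v)) ->
  (m1 \x m2)%E A = (m1 \x m2)%E B.
Proof.
move=> mA mB AB.
have E C : measurable C -> (m1 \x m2)%E C = (m1 \x^ m2)%E C.
  move=> mC; apply: product_measure_unique => // U V mU mV.
  exact: product_measure2E.
by rewrite !E//; apply: eq_integral => v _ /=; exact: AB.
Qed.

Definition sqr_len z := z 0 0 ^+ 2 + z 1 0 ^+ 2.

(** The inverse Euclidean length, as opposed to the maximum norm carried by matrices; as a real
    power it is measurable by [measurable_powR]. *)
Definition inv_len z := (sqr_len z) `^ (- 2^-1).

(* Identifying the plane with the complex numbers, [unit_conj y] is the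
   multiplication by [conj y / |y|]. *)
Definition unit_conj y : 'M[R]_2 :=
  inv_len y *: mx2 (y 0 0) (y 1 0) (- y 1 0) (y 0 0).

Lemma sqr_len_gt0 z : z != 0 -> 0 < sqr_len z.
Proof.
move=> z0; rewrite lt_neqAle eq_sym; apply/andP; split; last first.
  by rewrite addr_ge0 ?sqr_ge0.
apply: contra z0; rewrite paddr_eq0 ?sqr_ge0// !sqrf_eq0 => /andP[/eqP a /eqP b].
by apply/eqP/colP => i; rewrite mxE; have [->|->] := ord2P i.
Qed.

Lemma inv_len_sqr z : z != 0 -> inv_len z ^+ 2 * sqr_len z = 1.
Proof.
move=> /sqr_len_gt0 s0; rewrite /inv_len.
rewrite expr2 -powRD; last by rewrite (gt_eqF s0) implybT.
have -> : - 2^-1 + - 2^-1 = -1 :> R by field.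
by rewrite powR_inv1 ?ltW// mulVf ?gt_eqF.
Qed.

Lemma inv_len0 z : z != 0 -> inv_len z != 0.
Proof.
by move=> /inv_len_sqr; apply: contra_eq_neq => ->; rewrite expr0n mul0r eq_sym oner_eq0.
Qed.

Lemma unit_conj_rot y : y != 0 -> exists t, unit_conj y = rot t.
Proof.
move=> y0; have [|t _ [ct st]] := @unit_circle_angle _ (inv_len y * y 0 0)
    (inv_len y * - y 1 0).
  by rewrite -(inv_len_sqr y0) /sqr_len; ring.
by exists t; rewrite /unit_conj scale_mx2 /rot ct st; congr mx2; ring.
Qed.

Lemma measurable_unit_conj : measurable_fun setT unit_conj.
Proof.
have mc i : measurable_fun setT (fun z : 'cV[R]_2 => z i 0).
  exact: measurable_coord.
have ml : measurable_fun setT inv_len.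
  apply: (measurableT_comp (measurable_powR _)).
  by apply: measurable_funD; apply: measurable_funX.
apply: measurable_fun_mx => i j; rewrite /unit_conj; under eq_fun do rewrite mxE.
apply: measurable_funM => //; under eq_fun do rewrite mxE.
have [->|->] := ord2P i; have [->|->] := ord2P j.
- exact: mc.
- exact: mc.
- exact: (measurable_funN (mc 1)).
- exact: mc.
Qed.

Lemma mulmx_mx2_0 a b c d z : (mx2 a b c d *m z) 0 0 = a * z 0 0 + b * z 1 0.
Proof.
rewrite mxE !big_ord_recl big_ord0 addr0.
have -> : lift ord0 ord0 = 1 :> 'I_2 by apply: val_inj.
by rewrite !mxE.
Qed.

Lemma mulmx_mx2_1 a b c d z : (mx2 a b c d *m z) 1 0 = c * z 0 0 + d * z 1 0.
Proof.
rewrite mxE !big_ord_recl big_ord0 addr0.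
have -> : lift ord0 ord0 = 1 :> 'I_2 by apply: val_inj.
by rewrite !mxE.
Qed.

Lemma inv_len_rot t z : inv_len (rot t *m z) = inv_len z.
Proof.
congr (_ `^ _); rewrite /sqr_len /rot mulmx_mx2_0 mulmx_mx2_1.
have -> : z 0 0 ^+ 2 + z 1 0 ^+ 2 =
  (cos t ^+ 2 + sin t ^+ 2) * (z 0 0 ^+ 2 + z 1 0 ^+ 2) by rewrite cos2Dsin2 mul1r.
ring.
Qed.

(** In complex notation [e^(-i t) = x / |x|], so the two rotations turn [y] into [y x^2 / |x|^2].
    The left side is the conjugate of [x conj (y x^2) / (|x|^2 |y|)], which is [x y / |y|]. *)
Lemma refl_unit_conj t x y : x != 0 -> unit_conj x = rot t ->
  refl 0 *m (unit_conj (rot (- t) *m (rot (- t) *m y)) *m x) =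
  (unit_conj y)^T *m x.
Proof.
move=> x0; have r0 := inv_len0 x0.
rewrite /unit_conj !inv_len_rot scale_mx2 => /mx2_inj[xC xS _ _].
have {xC} xC : x 0 0 = (inv_len x)^-1 * cos t by rewrite -xC mulKf.
have {xS} xS : x 1 0 = (inv_len x)^-1 * - sin t by rewrite -xS mulKf.
have cs := cos2Dsin2 t.
move: (inv_len x) (inv_len y) r0 xC xS => r rho r0 xC xS.
rewrite /refl cos0 sin0 !scale_mx2 tr_mx2 /rot cosN sinN opprK.
apply/colP => i; have [->|->] := ord2P i.
- rewrite !(mulmx_mx2_0, mulmx_mx2_1) xC xS.
  transitivity (rho * r^-1 * ((cos t ^+ 2 + sin t ^+ 2) *
    (cos t * y 0 0 + sin t * y 1 0))); first by ring.
  by rewrite cs; ring.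
- rewrite !(mulmx_mx2_0, mulmx_mx2_1) xC xS.
  transitivity (rho * r^-1 * ((cos t ^+ 2 + sin t ^+ 2) *
    (cos t * y 1 0 - sin t * y 0 0))); first by ring.
  by rewrite cs; ring.
Qed.

Lemma tr_rot t : (rot t)^T = rot (- t) :> 'M[R]_2.
Proof. by rewrite /rot tr_mx2 cosN sinN opprK. Qed.

(** Two events on independent copies [x] and [y] are compared: [conj (x conj y / |y|)] in [E] for
    [A1], [x y / |y|] in [E] for [A2]. For fixed nonzero [y] the sections have the masses of the
    reflected [E] and of [E]; for fixed [x] they have equal mass. The common factor [mu nz] is
    positive and cancels. *)
Lemma rotation_invariant_refl (mu : probability 'cV[R]_2 R) :
  rotation_invariant mu -> mu [set 0] != 1%E ->
  eq_in_law (P := mu) (mulmx (refl 0)) id.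
Proof.
move=> inv mu0 E mE; set F : 'M[R]_2 := refl 0.
have pre (h : 'cV[R]_2 -> 'cV[R]_2) K : measurable_fun setT h ->
    measurable K -> measurable (h @^-1` K).
  by move=> mh mK; rewrite -[X in measurable X]setTI; exact: mh.
have rot_inv t K : measurable K -> mu (mulmx (rot t) @^-1` K) = mu K.
  by move=> mK; exact: (inv t K mK).
pose nz : set 'cV[R]_2 := ~` [set 0].
have mz : measurable [set 0 : 'cV[R]_2].
  by apply: closed_measurable_mx; exact/accessible_closed_set1/hausdorff_accessible/norm_hausdorff.
have mnz : measurable nz by exact: measurableC.
have nzP y : nz y <-> y != 0 by split=> [h|/eqP//]; exact/eqP.
have nzP2 t y : nz (rot (- t) *m (rot (- t) *m y)) <-> nz y.
  have ur := rot_unit (- t); split=> h y0; apply: h; first by rewrite y0 !mulmx0.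
  apply: (can_inj (mulKmx ur)); apply: (can_inj (mulKmx ur)).
  by rewrite !mulmx0.
have nz0 : ~ nz 0 by move=> /nzP; rewrite eqxx.
have mFE : measurable (mulmx F @^-1` E) by apply: pre => //; exact: measurable_mulmx.
pose A1 := [set p : 'cV[R]_2 * 'cV[R]_2 |
  nz p.2 /\ E (F *m (unit_conj p.2 *m p.1))].
pose A2 := [set p : 'cV[R]_2 * 'cV[R]_2 |
  nz p.2 /\ E ((unit_conj p.2)^T *m p.1)].
have mp2 : measurable ((snd : 'cV[R]_2 * 'cV[R]_2 -> _) @^-1` nz).
  by rewrite -[X in measurable X]setTI; exact: measurable_snd.
have mA1 : measurable A1.
  apply: measurableI => //; rewrite -[X in measurable X]setTI.
  apply: (measurable_mulmx_fun (f := fun=> F)) => //.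
  by apply: measurable_mulmx_fun => //; exact: (measurableT_comp measurable_unit_conj).
have mA2 : measurable A2.
  apply: measurableI => //; rewrite -[X in measurable X]setTI.
  apply: (measurable_mulmx_fun (f := fun p : 'cV[R]_2 * 'cV[R]_2 => (unit_conj p.2)^T)) => //.
  apply: measurable_fun_mx => i j; under eq_fun do rewrite mxE.
  apply: (measurableT_comp (measurable_coord j i)).
  exact: (measurableT_comp measurable_unit_conj).
have xs (A : set ('cV[R]_2 * 'cV[R]_2)) x : xsection A x = [set y | A (x, y)].
  by apply/seteqP; split=> y; rewrite /xsection /= inE.
have ys (A : set ('cV[R]_2 * 'cV[R]_2)) y : ysection A y = [set x | A (x, y)].
  by apply/seteqP; split=> x; rewrite /ysection /= inE.
have sec1 y : mu (ysection A1 y) = mu (ysection ((mulmx F @^-1` E) `*` nz) y).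
  rewrite !ys; have [->|y0] := eqVneq y 0.
    by congr (mu _); apply/seteqP; split=> x [? ?]; exfalso; exact: nz0.
  have [t yt] := unit_conj_rot y0; transitivity (mu (mulmx F @^-1` E)).
    rewrite -[RHS](rot_inv t)//; congr (mu _); apply/seteqP.
    by split=> x /=; rewrite /A1 /= yt; [case|split=> //; exact/nzP].
  by congr (mu _); apply/seteqP; split=> x /=; [split=> //; exact/nzP|case].
have sec2 y : mu (ysection A2 y) = mu (ysection (E `*` nz) y).
  rewrite !ys; have [->|y0] := eqVneq y 0.
    by congr (mu _); apply/seteqP; split=> x [? ?]; exfalso; exact: nz0.
  have [t yt] := unit_conj_rot y0; transitivity (mu E).
    rewrite -[RHS](rot_inv (- t))//; congr (mu _); apply/seteqP.
    by split=> x /=; rewrite /A2 /= yt tr_rot; [case|split=> //; exact/nzP].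
  by congr (mu _); apply/seteqP; split=> x /=; [split=> //; exact/nzP|case].
have sec12 x : mu (xsection A1 x) = mu (xsection A2 x).
  have [->|x0] := eqVneq x 0.
    rewrite !xs; congr (mu _); apply/seteqP.
    by split=> y; rewrite /A1 /A2 /= !mulmx0.
  have [t xt] := unit_conj_rot x0.
  (* Both sections are preimages of [K] under rotations: with complex numbers,
     [conj (x * conj y) / |y| = h (conj x * y / |x|)] and
     [x * y / |y| = h (x * y / |x|)] for [h w = |x| * w / |w|]. *)
  pose K := mulmx (rot (- t)) @^-1` xsection A1 x.
  have mK : measurable K.
    by apply: pre; [exact: measurable_rot|exact: measurable_xsection].
  have -> : xsection A1 x = mulmx (rot t) @^-1` K.
    by apply/seteqP; split=> y; rewrite /K /= mulmxA rotNr mul1mx.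
  have -> : xsection A2 x = mulmx (rot (- t)) @^-1` K.
    rewrite /K !xs; apply/seteqP; split=> y.
    - by move=> [/(nzP2 t) ny Ey]; split=> //=; rewrite -/F (refl_unit_conj _ x0 xt).
    - by move=> [/(nzP2 t) ny Ey]; split=> //=; rewrite -(refl_unit_conj _ x0 xt).
  exact: etrans (rot_inv _ _ mK) (esym (rot_inv _ _ mK)).
have e : (mu (mulmx F @^-1` E) * mu nz = mu E * mu nz)%E.
  rewrite -(product_measure1E mu mu mFE mnz) -(product_measure1E mu mu mE mnz).
  rewrite -(@product_measure_eq_ysection _ _ _ _ mu mu A1 _ mA1 (measurableX mFE mnz) sec1).
  rewrite -(@product_measure_eq_ysection _ _ _ _ mu mu A2 _ mA2 (measurableX mE mnz) sec2).
  exact: product_measure_eq_xsection.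
have nz_gt0 : (0 < mu nz)%E.
  rewrite lt_neqAle measure_ge0 andbT eq_sym; apply: contra mu0 => /eqP nz_null.
  by rewrite -[[set 0]]setCK probability_setC// -/nz nz_null sube0.
have nz_fin : mu nz \is a fin_num by exact: fin_num_measure.
have nz_fine : fine (mu nz) != 0 by rewrite gt_eqF// fine_gt0// nz_gt0 -ge0_fin_numE.
have F1 := fineK (fin_num_measure mu _ mFE); have F2 := fineK (fin_num_measure mu _ mE).
move: e; rewrite -(fineK nz_fin) -F1 -F2 -!EFinM => -[/(mulIf nz_fine) e].
by rewrite /pushforward -F1 e F2.
Qed.

End reflection_invariance.

(** * Symmetry groups with arbitrarily small rotations *)

Section dense_rotations.
Context {R : realType} (mu : probability 'cV[R]_2 R).

Definition translate_law (m : 'cV[R]_2) : probability 'cV[R]_2 R :=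
  distribution mu (mfun_of (measurable_addr (- m))).

Lemma translate_lawE m E : translate_law m E = mu ((fun z => z - m) @^-1` E).
Proof. by []. Qed.

(** Recentring at [m] changes the shift of [A] to [x + m - A m], which vanishes when
    [(A - 1) m = x]. *)
Lemma translate_law_sym m A x :
  eq_in_law (P := mu) (mulmx A) (fun z => z + x) ->
  eq_in_law (P := translate_law m) (mulmx A)
    (fun z => z + (x + m - A *m m)).
Proof.
move=> Ax E mE; have := eq_in_law_comp (measurable_addr (- (A *m m))) Ax mE.
rewrite /pushforward !translate_lawE => e.
transitivity (mu ((fun z => A *m z - A *m m) @^-1` E)).
  by congr (mu _); apply/seteqP; split=> z /=; rewrite mulmxBr.
rewrite e; congr (mu _); apply/seteqP; split=> z /=;
  by rewrite !addrA [z - m + x]addrAC subrK.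
Qed.

Lemma symmetry_group_translate m :
  symmetry_group (translate_law m) = symmetry_group mu.
Proof.
apply/seteqP; split=> A /symmetry_groupP[uA [x Ax]]; apply/symmetry_groupP;
  split=> //; last by exists (x + m - A *m m); exact: translate_law_sym.
exists (x - m + A *m m) => E mE.
have mh := measurable_addr (A *m m).
have := eq_in_law_comp mh Ax mE.
rewrite /pushforward !translate_lawE => e.
transitivity (mu ((fun z => A *m (z - m) + A *m m) @^-1` E)).
  by congr (mu _); apply/seteqP; split=> z /=; rewrite mulmxBr subrK.
apply: (etrans e); congr (mu _); apply/seteqP; split=> z /=;
  by rewrite !addrA [z - m + x]addrAC.
Qed.

Lemma rot_sub1_unit (t : R) : 0 < t < 1 -> rot t - 1%:M \in unitmx.
Proof.
move=> /andP[t0 t1]; rewrite unitmxE unitfE scalar_mx2 /rot.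
have -> : mx2 (cos t) (- sin t) (sin t) (cos t) - mx2 1 0 0 1 =
    mx2 (cos t - 1) (- sin t) (sin t) (cos t - 1).
  by apply/matrixP => i j; rewrite !mxE; have [->|->] := ord2P i;
    have [->|->] := ord2P j; rewrite /= ?subr0.
rewrite det_mx2; have s0 : 0 < sin t.
  by apply: sin_gt0_pi; rewrite t0/= (lt_le_trans t1)// (le_trans _ (pi_ge2 R))// ler1n.
apply: lt0r_neq0; rewrite mulNr opprK -!expr2 ltr_wpDl ?sqr_ge0//.
by rewrite exprn_gt0.
Qed.

(** One small rotation [R0] determines a centre [m]. Plane rotations commute, so the others in the
    group share this centre, and after recentring the law is invariant under all rotations and a
    reflection. *)
Lemma symmetry_group_dense_rotations : full mu ->
  (forall e, 0 < e -> exists2 t, symmetry_group mu (rot t) & 0 < t < e) ->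
  O2 `<=` symmetry_group mu.
Proof.
move=> fmu dense; have [t0 St0 t01] := dense 1 ltr01.
have u1 := rot_sub1_unit t01; set R0 := rot t0 in St0 u1.
have R0_fix (x : 'cV[R]_2) : R0 *m x = x -> x = 0.
  move=> xx; apply: (can_inj (mulKmx u1)).
  by rewrite mulmxBl mul1mx xx subrr mulmx0.
have [_ [x0 Ax0]] := (symmetry_groupP mu R0).1 St0.
pose m := invmx (R0 - 1%:M) *m x0; pose mu0 := translate_law m.
have R0_inv : eq_in_law (P := mu0) (mulmx R0) id.
  have E0 : x0 + m - R0 *m m = 0.
    have : (R0 - 1%:M) *m m = x0 by rewrite /m mulmxA mulmxV// mul1mx.
    by rewrite mulmxBl mul1mx => <-; rewrite subrK subrr.
  move=> E mE; have := translate_law_sym m Ax0 mE; rewrite /pushforward => ->.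
  by congr (mu0 _); apply/seteqP; split=> z /=; rewrite E0 addr0.
have S0 := symmetry_group_translate m; rewrite -S0 in dense *.
have inv : rotation_invariant mu0.
  apply: rotation_invariant_dense => // t /symmetry_groupP[_ [x Ax]].
  suff x0' : x = 0.
    move=> E mE; have := Ax E mE; rewrite /pushforward => ->.
    by congr (mu0 _); apply/seteqP; split=> z /=; rewrite x0' addr0.
  apply: R0_fix; apply: esym; apply: (@eq_in_law_shift_inj _ _ mu0).
  (* The law of [R0 (rot t z)] is computed in both orders: it is that of [z + x] and that of
     [z + R0 x]. Shifts are unique, so [R0] fixes [x]. *)
  apply: (@eq_in_law_trans _ _ _ _ mu0 _ (fun z => R0 *m (rot t *m z))).
    apply: eq_in_law_sym.
    have := eq_in_law_comp (measurable_rot t) R0_inv => h E mE.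
    have := eq_in_law_trans h Ax mE; rewrite /pushforward => <-.
    congr (mu0 _); apply/seteqP; split=> z /=;
      by rewrite !mulmxA /R0 !rotD addrC.
  apply: (eq_in_law_trans (eq_in_law_comp (measurable_rot t0) Ax)) => E mE.
  have := eq_in_law_comp (measurable_addr (R0 *m x)) R0_inv mE.
  rewrite /pushforward => <-.
  by congr (mu0 _); apply/seteqP; split=> z /=; rewrite mulmxDr.
have rotS t : symmetry_group mu0 (rot t).
  apply/symmetry_groupP; split; first exact: rot_unit.
  exists 0 => E mE; have := inv t E mE; rewrite /pushforward => ->.
  by congr (mu0 _); apply/seteqP; split=> z /=; rewrite addr0.
(* A unit mass at the centre would put [mu] on a line through [m], against fullness. *)
have mu00 : mu0 [set 0] != 1%E.
  have d0 : delta_mx 0 0 != 0 :> 'rV[R]_2.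
    by apply/eqP => /matrixP/(_ 0 0); rewrite !mxE => /eqP; rewrite oner_eq0.
  apply: (contra_neq _ (fmu (delta_mx 0 0) (m 0 0) d0)) => E1.
  apply/eqP; rewrite eq_le probability_le1 ?hyperplane_measurable//=.
  rewrite -[leLHS]E1 translate_lawE; apply: le_measure; rewrite ?inE.
  - have -> : (fun z : 'cV[R]_2 => z - m) @^-1` [set 0] = [set m].
      by apply/seteqP; split=> z /=; [move/subr0_eq|move=> ->; rewrite subrr].
    apply: closed_measurable_mx.
    exact/accessible_closed_set1/hausdorff_accessible/norm_hausdorff.
  - exact: hyperplane_measurable.
  - by move=> z /= /subr0_eq ->; rewrite -rowE mxE.
  - exact: hyperplane_measurable.
have reflS : symmetry_group mu0 (refl 0).
  apply/symmetry_groupP; split.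
    by have := refl_mul_refl (0 : R) 0; rewrite subrr rot0 => /mulmx1_unit[].
  exists 0 => E mE; have := rotation_invariant_refl inv mu00 mE.
  rewrite /pushforward => ->.
  by congr (mu0 _); apply/seteqP; split=> z /=; rewrite addr0.
move=> A [t [_ [->|->]]]; first exact: rotS.
by rewrite -[t]addr0 -rot_mul_refl; apply: symmetry_groupM.
Qed.

End dense_rotations.

(** * Symmetry groups of the Jordan forms *)

Section finite_plane_groups.
Context {R : realType}.
Implicit Types (G : set 'M[R]_2).

Lemma Cgrp1E : Cgrp 1 = [set 1%:M] :> set 'M[R]_2.
Proof.
apply/seteqP; split=> [_ [[|//] _ <-]|_ ->] /=.
  by rewrite mulr0 mul0r rot0.
by exists 0%N => //; rewrite mulr0 mul0r rot0.
Qed.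

Lemma rot_pi : rot pi = - 1%:M :> 'M[R]_2.
Proof. by rewrite /rot cospi sinpi scalar_mx2 opp_mx2 oppr0. Qed.

Lemma refl_pi : refl pi = - refl 0 :> 'M[R]_2.
Proof. by rewrite /refl cospi sinpi cos0 sin0 opp_mx2 oppr0 opprK. Qed.

Lemma half_turn : 2 * pi * 1%:R / 2%:R = pi :> R.
Proof. by field. Qed.

Lemma Cgrp2E : Cgrp 2 = [set 1%:M; - 1%:M] :> set 'M[R]_2.
Proof.
apply/seteqP; split=> [_ [[|[|//]] _ <-]|_ [->|->]] /=.
- by left; rewrite mulr0 mul0r rot0.
- by right; rewrite half_turn rot_pi.
- by exists 0%N => //; rewrite mulr0 mul0r rot0.
- by exists 1%N => //; rewrite half_turn rot_pi.
Qed.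

Lemma Dgrp1E : Dgrp 1 = [set 1%:M; refl 0] :> set 'M[R]_2.
Proof.
rewrite /Dgrp Cgrp1E; congr (_ `|` _).
apply/seteqP; split=> [_ [[|//] _ <-]|_ ->] /=; first by rewrite mulr0 mul0r.
by exists 0%N => //; rewrite mulr0 mul0r.
Qed.

Lemma Dgrp2E :
  Dgrp 2 = [set 1%:M; - 1%:M] `|` [set refl 0; - refl 0] :> set 'M[R]_2.
Proof.
rewrite /Dgrp Cgrp2E; congr (_ `|` _).
apply/seteqP; split=> [_ [[|[|//]] _ <-]|_ [->|->]] /=.
- by left; rewrite mulr0 mul0r.
- by right; rewrite half_turn refl_pi.
- by exists 0%N => //; rewrite mulr0 mul0r.
- by exists 1%N => //; rewrite half_turn refl_pi.
Qed.

Lemma sign_group_classification G : G 1%:M ->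
  G `<=` [set 1%:M; - 1%:M] -> G = Cgrp 1 \/ G = Cgrp 2.
Proof.
move=> G1 Gs; rewrite Cgrp1E Cgrp2E.
have [GN|GN] := pselect (G (- 1%:M)).
  by right; apply/seteqP; split=> // _ [->|->].
left; apply/seteqP; split=> [A GA|_ ->//].
by have [//|AN] := Gs _ GA; rewrite AN in GA.
Qed.

(** The subgroups of a Klein four-group, sorted by which of [- 1%:M], [refl 0] and [- refl 0] they
    contain. *)
Lemma diag_sign_group_classification G : G 1%:M ->
  (forall A B, G A -> G B -> G (A *m B)) ->
  G `<=` [set 1%:M; - 1%:M] `|` [set refl 0; - refl 0] ->
  G = Cgrp 1 \/ G = Cgrp 2 \/ G = Dgrp 1 \/ G = D1star \/ G = Dgrp 2.
Proof.
move=> G1 GM Gs.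
have FF : refl 0 *m refl 0 = 1%:M :> 'M[R]_2 by rewrite refl_mul_refl subrr rot0.
rewrite Dgrp1E Dgrp2E /D1star.
have [GN|GN] := pselect (G (- 1%:M)); have [GF|GF] := pselect (G (refl 0)).
- do 4 right; apply/seteqP; split=> // _ [[->|->]|[->|->]] //.
  by have := GM _ _ GN GF; rewrite mulNmx mul1mx.
- have GNF : ~ G (- refl 0).
    by move=> /(GM _ _ GN); rewrite mulNmx mul1mx opprK.
  have [|->|->] := @sign_group_classification G G1; [|by left|by right; left].
  by move=> A GA; have [//|[AE|AE]] := Gs _ GA; rewrite AE in GA.
- have GNF : ~ G (- refl 0).
    by move=> /(GM _ _ GF); rewrite mulmxN FF.
  right; right; left; apply/seteqP; split=> [A GA|_ [->|->]] //.
  by have [[AE|AE]|[AE|AE]] := Gs _ GA; rewrite AE in GA *; [left| |right|].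
- have [GNF|GNF] := pselect (G (- refl 0)).
    do 3 right; left; apply/seteqP; split=> [A GA|_ [->|->]] //.
    by have [[AE|AE]|[AE|AE]] := Gs _ GA; rewrite AE in GA *; [left| | |right].
  have [|->|->] := @sign_group_classification G G1; [|by left|by right; left].
  by move=> A GA; have [//|[AE|AE]] := Gs _ GA; rewrite AE in GA.
Qed.

End finite_plane_groups.

Section logarithms_of_integers.
Context {R : realType}.

Lemma ln_nat_unbounded (K : R) : exists n : nat, K < ln n.+1%:R.
Proof.
exists (Num.bound (expR K)); rewrite -ltr_expR lnK ?posrE ?ltr0n//.
apply: lt_trans (archi_boundP (expR_ge0 K)) _.
by rewrite ltr_nat.
Qed.

(** The gap is [ln (1 + 1 / n.+1)], at most [1 / n.+1]. Such small gaps between conjugating angles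
    later produce small rotations. *)
Lemma ln_nat_step (e : R) : 0 < e ->
  exists n : nat, 0 < ln (n.+2%:R : R) - ln n.+1%:R < e.
Proof.
move=> e0; have [n _ Ne] := near_infty_natSinv_lt (PosNum e0).
have {Ne}ne := Ne n (leqnn n).
exists n; rewrite subr_gt0 ltr_ln ?posrE ?ltr0n// ltr_nat ltnS leqnn/=.
apply: le_lt_trans ne; rewrite -ln_div ?posrE ?ltr0n//.
have -> : n.+2%:R / n.+1%:R = 1 + n.+1%:R^-1 :> R.
  by rewrite -[in LHS]natr1 mulrDl mulfV ?pnatr_eq0// mul1r.
have pos : 0 < 1 + n.+1%:R^-1 :> R by rewrite addr_gt0// invr_gt0 ltr0n.
by rewrite -ler_expR lnK ?posrE// expR_ge1Dx.
Qed.

End logarithms_of_integers.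

Lemma symmetry_group_bounded_group (R : realType) (mu : probability 'cV[R]_2 R) :
  full mu -> bounded_group (symmetry_group mu).
Proof.
move=> fmu; split.
- by move=> A [].
- exact: symmetry_group1.
- exact: symmetry_groupM.
- exact: symmetry_groupV.
- exact: symmetry_group_bounded.
Qed.

(** * Classification for each Jordan form *)

Section operator_stable_plane.
Context {R : realType} {dO : measure_display} {Omega : measurableType dO}.
Context {P : probability Omega R}.
Variables (X : R -> {RV P >-> 'cV[R]_2}) (B : 'M[R]_2).
Let mu : probability 'cV[R]_2 R := distribution P (X 1).
Hypotheses (LX : levy_process X) (fmu : full mu) (sX : operator_stable X B).

Lemma symmetry_group_conj_mpow n A :
  mpow n.+1%:R B \in unitmx -> symmetry_group mu A ->
  symmetry_group mu (invmx (mpow n.+1%:R B) *m A *m mpow n.+1%:R B).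
Proof.
move=> uM; have [_ /(_ n.+1%:R)] := sX; rewrite ltr0n => /(_ isT)[b XM].
exact: symmetry_group_conj XM.
Qed.

Lemma symmetry_group_jordan1 : jordan1 B ->
  symmetry_group mu = Cgrp 1 \/ symmetry_group mu = Cgrp 2 \/
  symmetry_group mu = Dgrp 1 \/ symmetry_group mu = D1star \/
  symmetry_group mu = Dgrp 2.
Proof.
move=> [b1 [b2 [_ _ b12 BE]]].
have bG := symmetry_group_bounded_group fmu.
have conj n p q r s : symmetry_group mu (mx2 p q r s) ->
    let x := expR (ln n.+1%:R * (b2 - b1)) in
    symmetry_group mu (mx2 p (q * x) (r / x) s).
  have ME : mpow n.+1%:R B = mx2 (expR (ln n.+1%:R * b1)) 0 0 (expR (ln n.+1%:R * b2)).
    by rewrite /mpow BE scale_mx2 !mulr0 mexp_diag.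
  have := @symmetry_group_conj_mpow n (mx2 p q r s); rewrite ME.
  rewrite mulrBr expRB; move: (expR_gt0 (ln n.+1%:R * b1)) (expR_gt0 (ln n.+1%:R * b2)).
  move: (expR (ln _ * b1)) (expR (ln _ * b2)) => u v u0 v0 h S.
  have {h} h := h^~ S; move: h.
  have D0 : u * v - 0 * 0 != 0 by rewrite mul0r subr0 mulf_neq0 ?gt_eqF.
  rewrite unitmxE det_mx2 unitfE => /(_ D0); rewrite invmx_mx2//.
  rewrite -scalemxAl -scalemxAl !mul_mx2 scale_mx2.
  congr (symmetry_group mu (mx2 _ _ _ _)); field; rewrite ?gt_eqF//.
have large (c : R) : 0 < c -> forall K, exists n : nat, K < expR (ln n.+1%:R * c) /\
    1 < expR (ln n.+1%:R * c).
  move=> c0 K; have [n] := ln_nat_unbounded (`|K| / c).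
  rewrite ltr_pdivrMr// => Kn; exists n.
  have h := expR_ge1Dx (ln n.+1%:R * c).
  by have := ler_norm K; have := normr_ge0 K; split; lra.
have diag A : symmetry_group mu A ->
    exists p s, [/\ A = mx2 p 0 0 s, p ^+ 2 = 1 & s ^+ 2 = 1].
  (* The sign of [b2 - b1] decides which off-diagonal entry is expanded by the conjugation. *)
  move: b12; rewrite neq_lt -subr_gt0 -[b2 < b1]subr_gt0 => /orP[b12|b21].
    apply: bounded_group_diag_conj_large => // K.
    have [n [Kn n1]] := large _ b12 K.
    by exists (expR (ln n.+1%:R * (b2 - b1))); split=> //; exact: conj.
  apply: bounded_group_diag_conj_small => // K.
  have [n [Kn n1]] := large _ b21 K.
  exists (expR (ln n.+1%:R * (b1 - b2))); split=> // p q r s /(conj n) /=.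
  by rewrite -(opprB b1 b2) mulrN expRN invrK.
have [uG G1 GM _ _] := bG.
apply: diag_sign_group_classification => // A /diag[p [s [-> /eqP p2 /eqP s2]]].
rewrite /refl cos0 sin0 scalar_mx2 !opp_mx2 !oppr0 opprK.
move: p2 s2; rewrite !sqrf_eq1.
by move=> /orP[]/eqP-> /orP[]/eqP->; [left; left|right; left|right; right|left; right].
Qed.

Lemma symmetry_group_jordan3 : jordan3 B ->
  symmetry_group mu = Cgrp 1 \/ symmetry_group mu = Cgrp 2.
Proof.
move=> [b [_ BE]]; have bG := symmetry_group_bounded_group fmu.
apply: sign_group_classification; first by case: bG.
move=> A; apply: (bounded_group_shear_conj bG) => K.
have [n Kn] := ln_nat_unbounded K; exists (ln n.+1%:R); split=> // p q r s.
(* A scalar times the shear with parameter [ln n.+1%:R]; the scalar cancels in the conjugation. *)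
have ME : mpow n.+1%:R B = expR (ln n.+1%:R * b) *: mx2 1 0 (ln n.+1%:R) 1.
  rewrite /mpow BE !scale_mx2 !mulr0 !mulr1 mexp_lower.
  by rewrite [_ * expR _]mulrC.
have := @symmetry_group_conj_mpow n (mx2 p q r s); rewrite ME scale_mx2.
move: (expR_gt0 (ln n.+1%:R * b)); move: (expR _) => u u0.
move: (ln _) => L h S.
have {h} := h _ S; have D0 : (u * 1) * (u * 1) - (u * 0) * (u * L) != 0.
  by rewrite mulr0 mul0r subr0 !mulr1 mulf_neq0 ?gt_eqF.
rewrite unitmxE det_mx2 unitfE => /(_ D0); rewrite invmx_mx2//.
rewrite -scalemxAl -scalemxAl !mul_mx2 scale_mx2.
by congr (symmetry_group mu (mx2 _ _ _ _)); field; rewrite ?gt_eqF.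
Qed.

Lemma symmetry_group_jordan2 : jordan2 B ->
  (exists n, (1 <= n)%N /\ symmetry_group mu = Cgrp n) \/
  symmetry_group mu = O2.
Proof.
move=> [b [c [_ c0 BE]]]; have bG := symmetry_group_bounded_group fmu.
pose L n : R := ln n.+1%:R.
have conj n A : symmetry_group mu A ->
    symmetry_group mu (rot (- (L n * c)) *m A *m rot (L n * c)).
  have ME : mpow n.+1%:R B = expR (L n * b) *: rot (L n * c).
    by rewrite /mpow BE scale_mx2 mulrN mexp_rot.
  have u0 := gt_eqF (expR_gt0 (L n * b)).
  have uu : expR (L n * b) \is a GRing.unit by rewrite unitfE u0.
  move=> /(@symmetry_group_conj_mpow n); rewrite ME.
  rewrite unitmxZ// rot_unit => /(_ isT).
  rewrite invmxZ ?unitmxZ ?rot_unit// invmx_rot -!scalemxAl -scalemxAr scalerA.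
  by rewrite mulVf ?u0// scale1r.
have step e : 0 < e -> exists n, 0 < `|(L n.+1 - L n) * c *+ 2| < e.
  move=> e0; have c2 : 0 < `|c| *+ 2 by rewrite mulrn_wgt0// normr_gt0.
  have [n /andP[n0 ne]] := ln_nat_step (divr_gt0 e0 c2).
  exists n; rewrite -mulrnAr normrM gtr0_norm// normrMn mulr_gt0//=.
  by rewrite -ltr_pdivlMr.
(* If every doubled angle were a multiple of [2 * pi], so would be their differences, but some
   difference has absolute value strictly between 0 and [pi]. *)
have [n cosn] : exists n, cos ((L n * c) *+ 2) != 1.
  have [n /andP[n0 npi]] := step _ (pi_gt0 R).
  apply: contrapT => /forallNP h.
  have {}h k : cos ((L k * c) *+ 2) = 1.
    by apply/eqP; apply: contrapT => /negP; exact: h.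
  have hs k : sin ((L k * c) *+ 2) = 0.
    by apply/eqP; rewrite -sqrf_eq0 sin2cos2 h expr1n subrr.
  have : cos `|(L n.+1 - L n) * c *+ 2| = 1.
    have -> : cos `|(L n.+1 - L n) * c *+ 2| = cos ((L n.+1 - L n) * c *+ 2).
      by case: ger0P => // _; rewrite cosN.
    by rewrite mulrBl mulrnBl cosB !h !hs mulr0 addr0 mulr1.
  rewrite -cos0 => /cos_inj; rewrite !in_itv /= lexx pi_ge0 normr_ge0 (ltW npi).
  by move=> /(_ isT isT) E; rewrite E ltxx in n0.
have GO2 : symmetry_group mu `<=` O2.
  exact: (bounded_group_rot_conj bG cosn (conj n)).
have dense_O2 : (forall e, 0 < e ->
    exists2 t, symmetry_group mu (rot t) & 0 < t < e) ->
    symmetry_group mu = O2.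
  by move=> dense; apply/seteqP; split=> //; exact: symmetry_group_dense_rotations.
have [_ G1 GM GV _] := bG.
have [[t St]|noref] := pselect (exists t, symmetry_group mu (refl t)).
  right; apply: dense_O2 => e /step[k].
  set d := (L k.+1 - L k) * c *+ 2 => de.
  (* Two consecutive conjugates of one reflection are reflections whose angles differ by [d], and
     their product is the rotation by [d]. *)
  have Sd : symmetry_group mu (rot d).
    have := GM _ _ (conj k _ St) (conj k.+1 _ St).
    rewrite !refl_conj refl_mul_refl; congr (symmetry_group mu (rot _)).
    by rewrite /d; ring.
  (* The sign of [d] is that of [c]; for negative [d] the inverse rotation is used. *)
  exists `|d| => //; case: ger0P => // _.
  by rewrite -invmx_rot; exact: GV.
have [|dense|[k k1 Sk]] := rotation_group_cyclic_or_dense bG GO2.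
- by move=> t St; apply: noref; exists t.
- by right; exact: dense_O2.
- by left; exists k.
Qed.

End operator_stable_plane.

Unset Implicit Arguments.

Theorem theorem5p1 (R : realType) (dO : measure_display)
    (Omega : measurableType dO) (P : probability Omega R)
    (X : R -> {RV P >-> 'cV[R]_2}) (B : 'M[R]_2) :
  let mu : probability 'cV[R]_2 R := distribution P (X 1) in
  levy_process X -> full mu -> operator_stable X B ->
  [\/ jordan0 B, jordan1 B, jordan2 B | jordan3 B] ->
  [/\ jordan1 B ->
        symmetry_group mu = Cgrp 1 \/ symmetry_group mu = Cgrp 2 \/
        symmetry_group mu = Dgrp 1 \/ symmetry_group mu = D1star \/
        symmetry_group mu = Dgrp 2,
      jordan2 B ->
        (exists n, (1 <= n)%N /\ symmetry_group mu = Cgrp n) \/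
        symmetry_group mu = O2 &
      jordan3 B ->
        symmetry_group mu = Cgrp 1 \/ symmetry_group mu = Cgrp 2].
Proof.
move=> mu LX fmu sX _; split.
- exact: symmetry_group_jordan1.
- exact: symmetry_group_jordan2.
- exact: symmetry_group_jordan3.
Qed.
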